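(* Let $f(x)\in\mathbb{F}_{q^n}[x]$ be a scattered polynomial, with $q>3$ and $n>2$. (i) If $|G_f|=q-1$ (i.e. $f\notin\mathcal{S}_{n,q}$), then the plane $\mathcal{A}_f$ admits no nontrivial group of affine central collineations, and the group of all collineations of $\mathcal{A}_f$ lying in $\mathrm{GL}(2,q^n)$ has order $q^n-1$ and equals the kernel homology group $\{(x,y)\mapsto(ax,ay)\colon a\in\mathbb{F}_{q^n}^*\}$ of the associated Desarguesian plane. (ii) If $f\in\mathcal{S}_{n,q}$ and $G_f$ is isomorphic to $\mathbb{F}_{q^t}^*$, then $\mathcal{A}_f$ admits cyclic symmetric affine homology groups of order $(q^t-1)/(q-1)$ but admits no nontrivial affine elation; there exist two distinct components $X$ and $Y$ of $\mathcal{A}_f$ such that every affine homology of $\mathcal{A}_f$ has center $X$ or $Y$, and $X,Y$ are elements of the Desarguesian spread $\mathcal{D}$ of $\mathbb{F}_{q^n}^2$; moreover the group of all collineations of $\mathcal{A}_f$ lying in $\mathrm{GL}(2,q^n)$ is the direct product of the kernel homology group of the associated Desarguesian plane (of order $q^n-1$) by a cyclic homology group of order $(q^t-1)/(q-1)$.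
   Context: $q$ is a prime power. A $q$-polynomial $f(x)=\sum_{i=0}^{n-1}a_ix^{q^i}\in\mathbb{F}_{q^n}[x]$ is scattered if for all $y,z\in\mathbb{F}_{q^n}$, $zf(y)-yf(z)=0$ implies $y,z$ are $\mathbb{F}_q$-linearly dependent. $U_f=\{(x,f(x))\colon x\in\mathbb{F}_{q^n}\}$; matrices act by $(x,y)\mapsto(x,y)A$; $G_f=\{A\in\mathrm{GL}(2,q^n)\colon U_fA=U_f\}$ (it always contains the scalar matrices $aI$, $a\in\mathbb{F}_q^*$); $\mathcal{S}_{n,q}$ is the set of scattered $f$ with $|G_f|>q-1$. $L_f=\{\langle(x,f(x))\rangle_{\mathbb{F}_{q^n}}\colon x\ne0\}$, $\mathcal{D}=\{\langle v\rangle_{\mathbb{F}_{q^n}}\colon v\ne0\}$; $\mathcal{B}_f=(\mathcal{D}\setminus L_f)\cup\{hU_f\colon h\in\mathbb{F}_{q^n}^*\}$ is a spread of $\mathbb{F}_{q^n}^2$ (as $2n$-dim $\mathbb{F}_q$-space), and $\mathcal{A}_f$ is the translation plane with points the vectors of $\mathbb{F}_{q^n}^2$ and lines the cosets $v+W$, $W\in\mathcal{B}_f$; the elements of $\mathcal{B}_f$ (components) are also the points at infinity. A central collineation of a projective plane is a nonidentity collineation fixing a line (axis) pointwise; it then fixes all lines through a unique point (center); it is an elation if the center lies on the axis and a homology otherwise. An affine central collineation (affine homology, affine elation) of $\mathcal{A}_f$ is a collineation whose extension to the projective closure is a central collineation (homology, elation) whose axis is an affine line; its center is then a component; an affine line through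 the center is a coaxis. Two groups $G,H$ of affine homologies are symmetric affine homology groups if there are lines $\ell,m$ such that $\ell$ is the axis of every element of $G$ and a coaxis of every element of $H$, and $m$ is the axis of every element of $H$ and a coaxis of every element of $G$. *)

(* Defs.v *)
From HB Require Import structures.
From mathcomp Require Import all_boot all_order all_algebra all_fingroup all_solvable all_field.
Set Implicit Arguments. Unset Strict Implicit. Unset Printing Implicit Defensive.
Import GRing.Theory.
Local Open Scope ring_scope.

(* F plays the role of F_{q^n}; the hypothesis #|F| = q^n is in the theorem. *)
Section Plane.
Variable F : finFieldType.
Variable q n : nat.
Variable a : 'I_n -> F.

Notation V := 'rV[F]_2.

Definition Fq : {set F} := [set x : F | x ^+ q == x].

Definition qpoly (x : F) : F := \sum_(i < n) a i * x ^+ (q ^ i)%N.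

Definition Fq_dependent (y z : F) : Prop :=
  exists l m : F, [/\ l \in Fq, m \in Fq, (l != 0) || (m != 0) & l * y + m * z = 0].

Definition scattered : Prop :=
  forall y z : F, z * qpoly y - y * qpoly z = 0 -> Fq_dependent y z.

Definition vec2 (x y : F) : V := \row_(j < 2) (if (j : nat) == 0%N then x else y).

Definition Uf : {set V} := [set vec2 x (qpoly x) | x : F].

Definition Gf : {set {'GL_2[F]}} :=
  [set g : {'GL_2[F]} | [set v *m GLval g | v in Uf] == Uf].

Definition span1 (v : V) : {set V} := [set c *: v | c : F].

Definition Dspread : {set {set V}} := [set span1 v | v in [set v : V | v != 0]].

Definition Lf : {set {set V}} :=
  [set span1 (vec2 x (qpoly x)) | x in [set x : F | x != 0]].

(* the spread B_f (components = points at infinity of A_f) *)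
Definition Bf : {set {set V}} :=
  (Dspread :\: Lf) :|: [set [set h *: u | u in Uf] | h in [set h : F | h != 0]].

Definition line (v : V) (W : {set V}) : {set V} := [set v + w | w in W].

Definition lines : {set {set V}} := [set line v W | v in [set: V], W in Bf].

(* collineations of A_f (finite plane: injective + lines go to lines) *)
Definition coll (s : V -> V) : bool :=
  injectiveb s && [forall l in lines, (s @: l) \in lines].

(* s is an affine central collineation with (affine) axis l and center W
   (W a component = point at infinity; all lines through W are fixed) *)
Definition affine_central (s : V -> V) (l W : {set V}) : Prop :=
  [/\ coll s, (exists x, s x != x), l \in lines & (forall x, x \in l -> s x = x)] /\
  (W \in Bf /\ forall v, s @: line v W = line v W).

(* the center lies on the axis iff the axis has direction W *)
Definition affine_elation (s : V -> V) (l W : {set V}) : Prop :=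
  affine_central s l W /\ exists v, l = line v W.

Definition affine_homology (s : V -> V) (l W : {set V}) : Prop :=
  affine_central s l W /\ ~ (exists v, l = line v W).

Definition coaxis (m W : {set V}) : Prop := exists v, m = line v W.

Definition symmetric_affine_homology_groups (G H : {set {perm V}}) : Prop :=
  exists l m : {set V},
    (forall s, s \in G -> s != 1%g -> exists W, affine_homology s l W /\ coaxis m W) /\
    (forall s, s \in H -> s != 1%g -> exists W, affine_homology s m W /\ coaxis l W).

Definition glmap (g : {'GL_2[F]}) (v : V) : V := v *m GLval g.

Definition CollGL : {set {'GL_2[F]}} := [set g : {'GL_2[F]} | coll (glmap g)].

Definition KerH : {set {'GL_2[F]}} :=
  [set g : {'GL_2[F]} | [exists c : F, (c != 0) && (GLval g == c%:M)]].

End Plane.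

Definition prime_power (q : nat) : Prop := exists p k, prime p /\ q = (p ^ k)%N.

(* Main.v *)
(** Let D be the Desarguesian spread and B = B_f, so that B \ D = {h U_f} has few elements.  A
    collineation s of A_f fixing 0 is additive, and for c in F_{q^n} the map s c s^-1 stabilises
    every component in B /\ D /\ s(B /\ D).  There are so many of these that s c s^-1 must be a
    scalar, i.e. s is semilinear.  If moreover s fixes a component pointwise, then s is linear, and
    the component lies in D unless s = 1.  So every affine central collineation is, up to a
    translation, an element of GL(2,q^n).

    A linear collineation preserves D and B, hence maps U_f to some h U_f, and is a scalar times an
    element of G_f; the scalars in G_f are those of F_q^*.  This gives (i).  For (ii), no
    nonidentity element of G_f fixes a nonzero vector of U_f, so |G_f| divides q^n - 1 and a
    generator g of the cyclic group G_f is diagonalisable over F_{q^n}.  Its two eigenlines X, Y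
    are not in L_f, and dividing g by either eigenvalue gives the two groups of homologies, with
    axes X and Y. *)
Require Import Defs.
From HB Require Import structures.
From mathcomp Require Import all_boot all_order all_algebra all_fingroup all_solvable all_field.
From mathcomp Require Import zify.
Set Implicit Arguments. Unset Strict Implicit. Unset Printing Implicit Defensive.
Import GRing.Theory.
Local Open Scope ring_scope.

(** * Two counting arguments for additive subgroups *)

(** The sum map on [A] x [B] is injective because [A] and [B] meet only in 0; the cardinality
    hypothesis makes it onto. *)
Lemma direct_sum_cover (V : finZmodType) (A B : {set V}) :
    zmod_closed A -> zmod_closed B -> (forall x, x \in A -> x \in B -> x = 0) ->
    (#|A| * #|B|)%N = #|V| ->
  forall v, exists2 a, a \in A & exists2 b, b \in B & v = a + b.
Proof.
move=> zA zB AB0 cAB v.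
pose f (p : V * V) := p.1 + p.2.
have f_inj : {in setX A B &, injective f}.
  move=> [x y] [x' y'] /setXP[Ax By] /setXP[Ax' By'] /= exy.
  have exy' : x - x' = y' - y.
    by apply/eqP; rewrite subr_eq addrAC eq_sym subr_eq addrC eq_sym; apply/eqP.
  have x0 : x - x' = 0.
    by apply: AB0; [exact: zA.2 | rewrite exy'; exact: zB.2].
  by congr (_, _); apply/eqP; rewrite -subr_eq0 ?x0 // -opprB -exy' x0 oppr0.
have fT : f @: setX A B = [set: V].
  by apply/eqP; rewrite eqEcard subsetT /= cardsT card_in_imset // cardsX cAB.
have : v \in f @: setX A B by rewrite fT inE.
by case/imsetP=> -[x y] /setXP[Ax By] ->; exists x => //; exists y.
Qed.

(* For z outside M, (x, y) |-> x + y z is injective on M x M. *)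
Lemma subfield_card (F : finFieldType) (M : {set F}) :
    zmod_closed M -> {in M &, forall x y, x / y \in M} ->
  M = [set: F] \/ (#|M| * #|M| <= #|F|)%N.
Proof.
move=> zM dM; case: (pickP [pred z | z \notin M]) => [z /= Mz | allM]; last first.
  by left; apply/setP=> z; move: (allM z) => /= /negbFE ->; rewrite inE.
right; rewrite -cardsX; pose f (p : F * F) := p.1 + p.2 * z.
have f_inj : {in setX M M &, injective f}.
  move=> [x y] [x' y'] /setXP[Ax Ay] /setXP[Ax' Ay']; rewrite /f /= => exy.
  have exy' : x - x' = (y' - y) * z.
    apply/eqP; rewrite mulrBl subr_eq addrAC eq_sym subr_eq addrC eq_sym.
    by rewrite exy addrC.
  have [y0|y0] := eqVneq (y' - y) 0.
    congr (_, _); last by apply/esym/eqP; rewrite -subr_eq0 y0.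
    by apply/eqP; rewrite -subr_eq0 exy' y0 mul0r.
  case/negP: Mz; have -> : z = (x - x') / (y' - y) by rewrite exy' mulrC mulKf.
  by apply: dM; exact: zM.2.
by rewrite -(card_in_imset f_inj) max_card.
Qed.

(** * Points, frames and spreads of the plane over F *)

Section Plane.
Variable F : finFieldType.
Local Notation V := 'rV[F]_2.
Implicit Types (u v w : V) (c x y : F) (W : {set V}).

Lemma card_plane : #|V| = (#|F| * #|F|)%N.
Proof. by rewrite card_mx mul1n expnS expn1. Qed.

Lemma span1P v w : reflect (exists c, w = c *: v) (w \in span1 v).
Proof.
by apply: (iffP imsetP) => [[c _ ->] | [c ->]]; exists c.
Qed.

Lemma mem_span1 v : v \in span1 v.
Proof. by apply/span1P; exists 1; rewrite scale1r. Qed.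

Lemma scale_span1 c v w : w \in span1 v -> c *: w \in span1 v.
Proof. by case/span1P=> d ->; apply/span1P; exists (c * d); rewrite scalerA. Qed.

Lemma span1_zmod v : zmod_closed (span1 v).
Proof.
split=> [|u w /span1P[c ->] /span1P[d ->]]; first by apply/span1P; exists 0; rewrite scale0r.
by apply/span1P; exists (c - d); rewrite scalerBl.
Qed.

Lemma span1_eq v w : w != 0 -> w \in span1 v -> span1 v = span1 w.
Proof.
move=> w0 /span1P[c ec]; have c0 : c != 0 by apply: contraNneq w0 => c0; rewrite ec c0 scale0r.
apply/setP=> u; apply/span1P/span1P => -[d ->].
  by exists (d / c); rewrite ec scalerA mulfVK.
by exists (d * c); rewrite ec scalerA.
Qed.

Lemma card_span1 v : v != 0 -> #|span1 v| = #|F|.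
Proof.
move=> v0; rewrite card_imset // => c d /eqP.
by rewrite -subr_eq0 -scalerBl scaler_eq0 (negPf v0) orbF subr_eq0 => /eqP.
Qed.

Lemma span1_Dspread v : v != 0 -> span1 v \in Dspread F.
Proof. by move=> v0; apply/imsetP; exists v; rewrite ?inE. Qed.

Lemma DspreadP W : W \in Dspread F -> exists2 v, v != 0 & W = span1 v.
Proof. by case/imsetP=> v; rewrite inE => v0 ->; exists v. Qed.

(** Bases of [V] are carried as frames: a nonzero [e1] and an [e2] off its span. Independence is
    proved here, generation in [frame_gen]. *)
Lemma frame_free e1 e2 x y : e1 != 0 -> e2 \notin span1 e1 ->
  x *: e1 + y *: e2 = 0 -> x = 0 /\ y = 0.
Proof.
move=> e10 e2e1 exy; have [y0|y0] := eqVneq y 0.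
  split=> //; apply/eqP; move/eqP: exy; rewrite y0 scale0r addr0 scaler_eq0.
  by rewrite (negPf e10) orbF.
case/span1P: e2e1; exists (- (x / y)).
move/eqP: exy; rewrite addrC addr_eq0 => /eqP ye2.
by rewrite -[e2]scale1r -(mulVf y0) -scalerA ye2 scalerN scalerA scaleNr mulrC.
Qed.

Lemma frame_gen e1 e2 v : e1 != 0 -> e2 \notin span1 e1 ->
  exists x y, v = x *: e1 + y *: e2.
Proof.
move=> e10 e2e1; have e20 : e2 != 0.
  by apply: contraNneq e2e1 => ->; exact: (span1_zmod _).1.
have [||||_ /span1P[x ->] [_ /span1P[y ->] ->]] :=
    @direct_sum_cover _ (span1 e1) (span1 e2) _ _ _ _ v; try exact: span1_zmod.
- move=> u ue1 /span1P[y uy]; have [//|u0] := eqVneq u 0.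
  case/negP: e2e1; rewrite (span1_eq u0 ue1) uy; apply/span1P.
  have y0 : y != 0 by apply: contraNneq u0 => y0; rewrite uy y0 scale0r.
  by exists y^-1; rewrite scalerA mulVf ?scale1r.
- by rewrite !card_span1 // card_plane.
by exists x, y.
Qed.

(** Components are additive subgroups and not F-subspaces, so that the notion covers both [Dspread]
    and the sets h U of [Bf]. *)
Record spread (B : {set {set V}}) : Prop := Spread {
  spread_zmod : forall W, W \in B -> zmod_closed W;
  spread_card : forall W, W \in B -> #|W| = #|F|;
  spread_ex : forall v, exists2 W, W \in B & v \in W;
  spread_uniq : forall W1 W2 v, W1 \in B -> W2 \in B ->
     v \in W1 -> v \in W2 -> v != 0 -> W1 = W2 }.

Lemma Dspread_spread : spread (Dspread F).
Proof.
split=> [W /DspreadP[v _ ->]|W /DspreadP[v v0 ->]|v|W1 W2 v].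
- exact: span1_zmod.
- exact: card_span1.
- have [->|v0] := eqVneq v 0; last first.
    by exists (span1 v); [exact: span1_Dspread | exact: mem_span1].
  have u0 : const_mx 1 != 0 :> V by apply/eqP => /rowP /(_ 0)/eqP; rewrite !mxE oner_eq0.
  by exists (span1 (const_mx 1)); [exact: span1_Dspread | exact: (span1_zmod _).1].
move=> /DspreadP[v1 _ ->] /DspreadP[v2 _ ->] e1 e2 v0.
by rewrite (span1_eq v0 e1) (span1_eq v0 e2).
Qed.

(** The components without 0 partition the nonzero vectors, so |B| (|F| - 1) = |F|^2 - 1. *)
Lemma spread_cardE B : spread B -> #|B| = #|F|.+1.
Proof.
case=> zB cB eB uB.
have F1 : (1 < #|F|)%N by exact: finNzRing_gt1.
have cT : #|[set v : V | v != 0]| = (#|B| * (#|F| - 1))%N.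
  pose P := [set W :\ 0 | W in B].
  have injP : {in B &, injective (fun W => W :\ 0)}.
    by move=> W W' /zB[W0 _] /zB[W'0 _] eW; rewrite -(setD1K W0) eW setD1K.
  rewrite -(card_in_imset injP); apply: card_uniform_partition.
    move=> _ /imsetP[W BW ->]; have := cardsD1 0 W.
    rewrite (zB _ BW).1 (cB _ BW) => ->; rewrite addKn; reflexivity.
  apply/and3P; split.
  - apply/eqP/setP=> v; rewrite inE; apply/bigcupP/idP.
      by case=> _ /imsetP[W _ ->]; rewrite !inE => /andP[].
    move=> v0; have [W BW Wv] := eB v.
    by exists (W :\ 0); [apply/imsetP; exists W | rewrite !inE v0].
  - apply/trivIsetP => _ _ /imsetP[W BW ->] /imsetP[W' BW' ->] nWW.
    apply/pred0P=> v /=; apply/negbTE; apply: contra nWW.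
    rewrite !inE => /andP[/andP[v0 Wv] /andP[_ W'v]].
    by rewrite (uB _ _ _ BW BW' Wv W'v v0).
  apply/imsetP=> -[W BW W0]; have := cB _ BW.
  by rewrite -(setD1K (zB _ BW).1) -W0 setU0 cards1 => F1'; rewrite -F1' in F1.
have cT' : #|[set v : V | v != 0]| = (#|F| * #|F| - 1)%N.
  have -> : [set v : V | v != 0] = setT :\ 0 by apply/setP=> v; rewrite !inE andbT.
  by rewrite -card_plane -(cardsT V) (cardsD1 0 [set: V]) inE add1n subn1.
apply/eqP; rewrite -(@eqn_pmul2r (#|F| - 1)) ?subn_gt0 // -cT cT'; apply/eqP; nia.
Qed.

End Plane.

(** * Collineations of a spread plane: additivity and semilinearity *)

Section Collineations.
Variable F : finFieldType.
Local Notation V := 'rV[F]_2.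
Implicit Types (u v w : V) (c x y : F) (W : {set V}) (B : {set {set V}}).

Lemma mem_line u v W : (u \in line v W) = (u - v \in W).
Proof.
apply/imsetP/idP => [[w Ww ->]|Wu]; first by rewrite addrC addKr.
by exists (u - v) => //; rewrite addrC subrK.
Qed.

Lemma line_eq u v W : zmod_closed W -> u \in line v W -> line v W = line u W.
Proof.
move=> zW; rewrite mem_line => Wuv; apply/setP=> w; rewrite !mem_line.
have e1 : w - u = (w - v) - (u - v) by rewrite opprB addrA subrK.
apply/idP/idP => Ww; first by rewrite e1; exact: zW.2.
by rewrite -(subrK (u - v) (w - v)) -e1; exact: (GRing.zmod_closedD zW).2.
Qed.

Lemma line0 W : line 0 W = W.
Proof. by apply/setP=> u; rewrite mem_line subr0. Qed.

Lemma spread_disjoint B W1 W2 v : spread B -> W1 \in B -> W2 \in B -> W1 != W2 ->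
  v \in W1 -> v \in W2 -> v = 0.
Proof.
move=> spB B1 B2 n12 v1 v2; apply/eqP; apply: contraNT n12 => v0.
exact/eqP/(spread_uniq spB B1 B2 v1 v2).
Qed.

Lemma spread_cover B W1 W2 : spread B -> W1 \in B -> W2 \in B -> W1 != W2 ->
  forall v, exists2 a, a \in W1 & exists2 b, b \in W2 & v = a + b.
Proof.
move=> spB B1 B2 n12; apply: direct_sum_cover; try exact: (spread_zmod spB).
  by move=> x; exact: (spread_disjoint spB B1 B2 n12).
by rewrite !(spread_card spB) // card_plane.
Qed.

Lemma spread_notin B W : spread B -> W \in B -> exists v, v \notin W.
Proof.
move=> spB BW; case: (pickP [pred v | v \notin W]) => [v|allW]; first by exists v.
have WT : W = setT by apply/setP=> v; move: (allW v); rewrite /= inE => /negbFE.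
have := spread_card spB BW; rewrite WT cardsT card_plane => e.
have F1 : (1 < #|F|)%N by exact: finNzRing_gt1.
by nia.
Qed.

Section FixingOrigin.
Variables (B : {set {set V}}) (s : V -> V).
Hypotheses (spB : spread B) (s_inj : injective s) (s0 : s 0 = 0).
Hypothesis s_line : forall v W, W \in B ->
  exists v' W', W' \in B /\ s @: line v W = line v' W'.

Lemma coll0_component W : W \in B -> s @: W \in B.
Proof.
move=> BW; have [v' [W' [BW' eW']]] := s_line 0 BW.
have : s 0 \in s @: line 0 W by rewrite imset_f // line0 (spread_zmod spB BW).1.
rewrite eW' s0 => /(line_eq (spread_zmod spB BW')) e.
by rewrite -{1}(line0 W) eW' e line0.
Qed.

(** If the image of v + W had a direction other than s(W), it would meet s(W); by injectivity v + W
    would meet W, hence equal W, and its image would be s(W) after all. *)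
Lemma coll0_line v W : W \in B -> s @: line v W = line (s v) (s @: W).
Proof.
move=> BW; have [v' [W' [BW' eW']]] := s_line v BW.
have zW := spread_zmod spB BW; have zW' := spread_zmod spB BW'.
have vvW : v \in line v W by rewrite mem_line subrr zW.1.
have := imset_f s vvW; rewrite eW' => /(line_eq zW') e; rewrite e.
have [->//|nW'] := eqVneq W' (s @: W).
have [a W'a [b /imsetP[y Wy eb] sv]] := spread_cover spB BW' (coll0_component BW) nW' (s v).
have : b \in line v' W'.
  by rewrite e mem_line sv opprD addrCA subrr addr0; exact: GRing.zmod_closedN.
rewrite -eW' => /imsetP[x]; rewrite eb => xW /s_inj exy; move: xW; rewrite -exy mem_line.
move=> Wyv; have Wv : v \in W by rewrite -[v](subKr y); exact: zW.2.
have vW : line v W = W.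
  rewrite -[RHS](line0 W); symmetry; apply: line_eq => //.
  by rewrite mem_line subr0.
have : 0 \in line v' W' by rewrite -eW' vW -s0 imset_f ?zW.1.
by move=> /(line_eq zW') e'; case/eqP: nW'; rewrite -{1}vW eW' e' line0.
Qed.

(** Parallelogram argument: with y in W', the sum x + y lies on x + W' and on y + W, so s (x + y) -
    s x - s y lies in both s(W') and s(W), which meet only in 0. *)
Lemma coll0_additive_out (x y : V) W : W \in B -> x \in W -> y \notin W -> s (x + y) = s x + s y.
Proof.
move=> BW Wx nWy; have [W' BW' W'y] := spread_ex spB y.
have nWW : W != W' by apply: contraNneq nWy => ->.
apply/eqP; rewrite -subr_eq0; set d := _ - _.
have d1 : d \in s @: W'.
  rewrite /d opprD addrA.
  have : s (x + y) \in s @: line x W' by rewrite imset_f // mem_line addrC addKr.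
  rewrite coll0_line // mem_line => h.
  by apply: (spread_zmod spB (coll0_component BW')).2 => //; exact: imset_f.
have d2 : d \in s @: W.
  rewrite /d opprD addrCA addrC.
  have : s (x + y) \in s @: line y W by rewrite imset_f // mem_line addrK.
  rewrite coll0_line // mem_line => h.
  by apply: (spread_zmod spB (coll0_component BW)).2 => //; exact: imset_f.
case/imsetP: d1 d2 => a W'a ->; rewrite (mem_imset _ _ s_inj) => Wa.
by rewrite (spread_disjoint spB BW BW' nWW Wa W'a) s0.
Qed.

Lemma coll0_additive : {morph s : u v / u + v}.
Proof.
move=> x y; have [W BW Wx] := spread_ex spB x.
have zW := spread_zmod spB BW.
have [Wy|] := boolP (y \in W); last exact: coll0_additive_out.
(* A vector z outside W reduces to the previous case: s (x + y + z) is expanded in two ways and s z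
   is cancelled. *)
have [z nWz] := spread_notin spB BW.
have nWyz : y + z \notin W.
  by apply: contra nWz => Wyz; rewrite -(addKr y z) addrC; exact: zW.2.
apply: (addIr (s z)); rewrite -(coll0_additive_out BW _ nWz) ?(GRing.zmod_closedD zW).2 //.
by rewrite -addrA (coll0_additive_out BW Wx nWyz) (coll0_additive_out BW Wy nWz) addrA.
Qed.

End FixingOrigin.

(** Three distinct points have the form <v1>, <v2>, <x v1 + y v2> with x and y nonzero; rescaling
    takes e1 = x v1 and e2 = y v2. *)
Lemma Dspread_frame (T : {set {set V}}) : T \subset Dspread F -> (2 < #|T|)%N ->
  exists e1 e2 : V, [/\ e1 != 0, e2 != 0, e2 \notin span1 e1 &
     [/\ span1 e1 \in T, span1 e2 \in T & span1 (e1 + e2) \in T]].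
Proof.
move=> /subsetP TD /card_gt2P[X1 [X2 [X3 [[T1 T2 T3] []]]]].
have [v1 v10 X1E] := DspreadP (TD _ T1); have [v2 v20 X2E] := DspreadP (TD _ T2).
have [v3 v30 X3E] := DspreadP (TD _ T3); rewrite {}X1E {}X2E {}X3E in T1 T2 T3 *.
move=> n12 n23 n31.
have v2v1 : v2 \notin span1 v1 by apply: contraNN n12 => /(span1_eq v20) ->.
have [x [y v3E]] := frame_gen v3 v10 v2v1.
have x0 : x != 0.
  apply: contraNneq n23 => x0; apply/eqP/span1_eq => //.
  by apply/span1P; exists y; rewrite v3E x0 scale0r add0r.
have y0 : y != 0.
  apply: contraNneq n31 => y0; apply/eqP; symmetry; apply/span1_eq => //.
  by apply/span1P; exists x; rewrite v3E y0 scale0r addr0.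
have s1 : span1 (x *: v1) = span1 v1.
  by symmetry; apply: span1_eq; rewrite ?scaler_eq0 ?negb_or ?x0 //; exact/scale_span1/mem_span1.
have s2 : span1 (y *: v2) = span1 v2.
  by symmetry; apply: span1_eq; rewrite ?scaler_eq0 ?negb_or ?y0 //; exact/scale_span1/mem_span1.
exists (x *: v1), (y *: v2); rewrite !scaler_eq0 !negb_or x0 y0 v10 v20 s1 s2 -v3E.
split=> //; apply: contra v2v1 => /(scale_span1 y^-1).
by rewrite scalerA mulVf // scale1r.
Qed.

(* In a frame e1, e2, e1 + e2 of stabilised points, phi acts on both coordinates by the same
   additive map alpha, and <e1 + m e2> is stabilised iff alpha commutes with multiplication
   by m; such m form a subfield, too large to be proper. *)
Lemma stab_many_scalar (T : {set {set V}}) (phi : V -> V) :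
    T \subset Dspread F -> (9 < #|F|)%N -> (#|F| < 3 * (#|T| - 1))%N ->
    {morph phi : u v / u + v} -> (forall W v, W \in T -> v \in W -> phi v \in W) ->
  exists c, forall v, phi v = c *: v.
Proof.
move=> TD F9 cT phiD phiT.
have [|e1 [e2 [e10 e20 e2e1 [T1 T2 T3]]]] := Dspread_frame TD; first by lia.
have indep := frame_free e10 e2e1.
have phiE x : exists a, phi (x *: e1) = a *: e1 /\ phi (x *: e2) = a *: e2.
  have /span1P[a ea] := phiT _ _ T1 (scale_span1 x (mem_span1 e1)).
  have /span1P[b eb] := phiT _ _ T2 (scale_span1 x (mem_span1 e2)).
  have /span1P[d ed] := phiT _ _ T3 (scale_span1 x (mem_span1 (e1 + e2))).
  move/eqP: ed; rewrite scalerDr phiD ea eb scalerDr -subr_eq0 opprD addrACA -!scalerBl.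
  move=> /eqP /indep[/eqP]; rewrite subr_eq0 => /eqP ad /eqP; rewrite subr_eq0 => /eqP bd.
  by exists a; rewrite ad bd.
have [alpha alphaE] := fin_all_exists phiE.
have al1 x : phi (x *: e1) = alpha x *: e1 by case: (alphaE x).
have al2 x : phi (x *: e2) = alpha x *: e2 by case: (alphaE x).
have e1_inj x y : x *: e1 = y *: e1 -> x = y.
  move/eqP; rewrite -subr_eq0 -scalerBl scaler_eq0 (negPf e10) orbF subr_eq0.
  by move/eqP.
have alD : {morph alpha : x y / x + y}.
  by move=> x y; apply: e1_inj; rewrite -al1 !scalerDl phiD !al1.
have al0 : alpha 0 = 0 by apply: (addIr (alpha 0)); rewrite -alD !add0r.
have alN x : alpha (- x) = - alpha x.
  by apply/eqP; rewrite -addr_eq0 -alD addNr al0.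
pose M := [set m : F | [forall x, alpha (m * x) == m * alpha x]].
have MP m : reflect (forall x, alpha (m * x) = m * alpha x) (m \in M).
  by rewrite inE; apply: (iffP forallP) => h x; apply/eqP.
have M0 : 0 \in M by apply/MP=> x; rewrite !mul0r.
have MT : M = setT.
  case: (@subfield_card _ M) => //.
  - split=> // m m' /MP hm /MP hm'; apply/MP=> x.
    by rewrite !mulrBl alD alN hm hm'.
  - move=> m m' /MP hm /MP hm'; have [->|m0] := eqVneq m' 0; first by rewrite invr0 mulr0.
    by apply/MP=> x; apply: (mulfI m0); rewrite -hm' !mulrA [m' * m]mulrC mulfK // hm.
  have : (#|T :\ span1 e2| <= #|[set span1 (e1 + m *: e2) | m in M]|)%N.
    apply/subset_leq_card/subsetP => W; rewrite in_setD1 => /andP[nW TW].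
    have [w w0 eW] := DspreadP (subsetP TD _ TW).
    have [x [y ew]] := frame_gen w e10 e2e1.
    have x0 : x != 0.
      apply: contraNneq nW => x0; rewrite eW; apply/eqP; symmetry; apply: span1_eq => //.
      by apply/span1P; exists y; rewrite ew x0 scale0r add0r.
    have eW' : W = span1 (e1 + (y / x) *: e2).
      symmetry; rewrite eW; apply: span1_eq => //; apply/span1P; exists x.
      by rewrite ew scalerDr scalerA mulrCA mulfV // mulr1.
    apply/imsetP; exists (y / x) => //; apply/MP=> z; move: (y / x) eW' => m eW'.
    have : phi (z *: (e1 + m *: e2)) \in W.
      by apply: phiT => //; rewrite eW'; exact/scale_span1/mem_span1.
    rewrite eW' scalerDr scalerA phiD al1 al2 => /span1P[d /eqP].
    rewrite scalerDr scalerA -subr_eq0 opprD addrACA -!scalerBl => /eqP /indep[/eqP].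
    by rewrite subr_eq0 => /eqP -> /eqP; rewrite subr_eq0 mulrC [d * m]mulrC => /eqP.
  move=> h1; have h2 := leq_trans h1 (leq_imset_card _ _).
  have := cardsD1 (span1 e2) T; rewrite T2 => h3 h4.
  (* With |M|^2 <= |F| < 3 (|T| - 1) this gives |M| < 3, hence |F| < 9, a contradiction. *)
  have h5 : (#|T| - 1 <= #|M|)%N by rewrite h3 add1n subn1.
  by nia.
exists (alpha 1) => v; have [x [y ->]] := frame_gen v e10 e2e1.
have alE m : alpha m = m * alpha 1.
  by have /MP/(_ 1) : m \in M; rewrite ?MT ?inE // mulr1.
by rewrite phiD al1 al2 scalerDr !scalerA alE (alE y) ![alpha 1 * _]mulrC.
Qed.

(** With N = B :&: D, the set T = N :&: s(N) misses at most 2 |B :\: D| of the |F| + 1 components,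
    so |T| - 1 >= |F| - 2 |B :\: D| > |F| / 3. This is the count that [stab_many_scalar] requires
    for the conjugate s c s^-1. *)
Lemma spread_semilinear B (s : V -> V) :
    spread B -> injective s -> {morph s : u v / u + v} -> (forall W, W \in B -> s @: W \in B) ->
    (9 < #|F|)%N -> (3 * #|B :\: Dspread F| < #|F|)%N ->
  forall c, exists c', forall v, s (c *: v) = c' *: s v.
Proof.
move=> spB s_inj sD sB F9 cBD c.
pose N := B :&: Dspread F; pose T := N :&: [set s @: (W : {set V}) | W in N].
pose s' := invF s_inj.
have sB_inj : injective (fun W => s @: W) by exact: imset_inj.
have sBB : [set s @: (W : {set V}) | W in B] = B.
  apply/eqP; rewrite eqEcard card_imset // leqnn andbT.
  by apply/subsetP => _ /imsetP[W BW ->]; exact: sB.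
have TD : T \subset Dspread F by apply/subsetP=> W /setIP[/setIP[]].
have cT : (#|B| <= #|T| + 2 * #|B :\: Dspread F|)%N.
  (* A component outside T lies outside D or is the image of a component outside D. *)
  have : B \subset T :|: ((B :\: Dspread F) :|: [set s @: (W : {set V}) | W in B :\: Dspread F]).
    apply/subsetP=> W BW; have := BW; rewrite -{1}sBB => /imsetP[W' BW' eW].
    rewrite !inE BW /=; have [WD|nWD] := boolP (W \in Dspread F); rewrite ?orbT //=.
    have [WD'|nWD'] := boolP (W' \in Dspread F).
      by apply/orP; left; apply/imsetP; exists W'; rewrite // inE BW'.
    by apply/orP; right; apply/imsetP; exists W'; rewrite // inE BW' nWD'.
  move/subset_leq_card/leq_trans; apply; apply: leq_trans (leq_card_setU _ _).1 _.
  rewrite leq_add2l mul2n -addnn; apply: leq_trans (leq_card_setU _ _).1 _.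
  by rewrite leq_add2l leq_imset_card.
have cB := spread_cardE spB.
have [//|//||||c' hc'] := @stab_many_scalar T (fun v => s (c *: s' v)).
- by lia.
- move=> u v; rewrite -sD -scalerDr; congr (s (_ *: _)).
  by apply: (s_inj); rewrite sD !f_invF.
- move=> W v /setIP[NW /imsetP[W' /setIP[BW' /DspreadP[w _ eW']] eW]].
  rewrite eW => /imsetP[u W'u ->]; rewrite /s' invF_f mem_imset //.
  by rewrite eW'; apply: scale_span1; rewrite -eW'.
by exists c' => v; rewrite -hc' /s' invF_f.
Qed.

End Collineations.

(** * The subfield of order q *)

Section Subfield.
Variables (F : finFieldType) (q n : nat).
Hypotheses (hq : prime_power q) (hF : #|F| = (q ^ n)%N) (q1 : (1 < q)%N).
Implicit Types (x y l : F).

Lemma exprDq i x y : (x + y) ^+ (q ^ i) = x ^+ (q ^ i) + y ^+ (q ^ i).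
Proof.
case: hq => p [k [p_pr qE]]; apply: exprDn_pchar; rewrite qE -expnM.
have pF : p \in [pchar F].
  by apply: (@card_finPcharP F p (k * n)%N) => //; rewrite hF qE expnM.
by rewrite pnatX (eq_pnat _ (pcharf_eq pF)) pnat_id.
Qed.

Lemma FqP l : reflect (l ^+ q = l) (l \in Fq F q).
Proof. by rewrite inE; exact: eqP. Qed.

Lemma exprFq i l : l \in Fq F q -> l ^+ (q ^ i) = l.
Proof.
by move=> /FqP hl; elim: i => [|i IHi]; rewrite ?expr1 // expnSr exprM IHi.
Qed.

Lemma Fq_zmod : zmod_closed (Fq F q).
Proof.
have D x y : (x + y) ^+ q = x ^+ q + y ^+ q by have := exprDq 1 x y; rewrite expn1.
split=> [|x y /FqP hx /FqP hy]; apply/FqP; first by rewrite expr0n; case: q q1.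
by apply: (addIr (y ^+ q)); rewrite -D subrK hx hy subrK.
Qed.

Lemma Fq_div : {in Fq F q &, forall x y, x / y \in Fq F q}.
Proof. by move=> x y /FqP hx /FqP hy; apply/FqP; rewrite exprMn exprVn hx hy. Qed.

(** At most q elements, as roots of X^q - X. At least q, because F^* is cyclic of order q^n - 1, a
    multiple of q - 1, and its subgroup of order q - 1 together with 0 lies in [Fq]. *)
Lemma card_Fq : #|Fq F q| = q.
Proof.
apply/eqP; rewrite eqn_leq; apply/andP; split.
  have sp : size ('X^q - 'X : {poly F}) = q.+1.
    by rewrite size_polyDl ?size_polyXn // size_polyN size_polyX.
  rewrite -ltnS -sp cardE; apply: max_poly_roots; rewrite -?size_poly_eq0 ?sp //.
  - by apply/allP=> x; rewrite mem_enum => /FqP hx; rewrite rootE !hornerE hx subrr.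
  - exact: enum_uniq.
have dvq : (q - 1 %| #|[set: {unit F}]|)%N.
  rewrite card_finField_unit hF -subn1 -[in X in (_ %| X)%N](exp1n n) subn_exp.
  exact: dvdn_mulr.
have /cyclicP[z zE] := field_unit_group_cyclic [set: {unit F}].
have oz : #[z]%g = #|[set: {unit F}]| by rewrite zE.
have oz0 : #[(z ^+ (#[z] %/ (q - 1)))%g]%g = (q - 1)%N.
  rewrite orderXdiv; last by rewrite dvdn_div // oz.
  by rewrite divnA ?oz // mulKn.
set z0 := (z ^+ _)%g in oz0.
have : (0 |: [set val u | u in <[z0]>%g] \subset Fq F q).
  apply/subsetP=> x; rewrite in_setU1 => /orP[/eqP ->|/imsetP[u zu ->]].
    exact: Fq_zmod.1.
  apply/FqP; rewrite -[in LHS](@subnK 1 q) 1?ltnW // addn1 exprSr.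
  have : (u ^+ (q - 1) = 1)%g.
    by apply/eqP; rewrite -order_dvdn -oz0; exact: order_dvdG.
  by move/(congr1 val); rewrite FinRing.val_unitX /= => ->; rewrite mul1r.
move/subset_leq_card; rewrite cardsU1 card_imset; last exact: val_inj.
rewrite -orderE oz0; case: imsetP => [[u _ u0]|_] /=; last by rewrite add1n subn1 (ltn_predK q1).
by have := valP u; rewrite /= -u0 unitr0.
Qed.

End Subfield.

(** * The spread B_f of a scattered polynomial *)

Section ScatteredSpread.
Variables (F : finFieldType) (q n : nat) (a : 'I_n -> F).
Hypotheses (hq : prime_power q) (hF : #|F| = (q ^ n)%N) (hq3 : (3 < q)%N) (hn2 : (2 < n)%N).
Hypothesis hsc : scattered q a.
Local Notation V := 'rV[F]_2.
Local Notation f := (Defs.qpoly q a).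
Local Notation U := (Uf q a).
Local Notation B := (Bf q a).
Local Notation hU h := [set h *: u | u in Uf q a].
Implicit Types (u v w : V) (h x y l : F) (W : {set V}).

Let q1 : (1 < q)%N. Proof. by rewrite (leq_trans _ hq3). Qed.

Lemma card_field_gt : (q * q < #|F|)%N.
Proof. by rewrite hF -[(q * q)%N]/(q ^ 2)%N ltn_exp2l. Qed.

Lemma qpolyD x y : f (x + y) = f x + f y.
Proof.
rewrite /Defs.qpoly -big_split /=; apply: eq_bigr => i _.
by rewrite (exprDq hq hF) mulrDr.
Qed.

Lemma qpolyZ l x : l \in Fq F q -> f (l * x) = l * f x.
Proof.
move=> hl; rewrite /Defs.qpoly mulr_sumr; apply: eq_bigr => i _.
by rewrite exprMn (exprFq _ hl) mulrCA.
Qed.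

Lemma qpoly0 : f 0 = 0.
Proof. by have := qpolyZ 0 (Fq_zmod hq hF q1).1; rewrite !mul0r. Qed.

Lemma vec2D x y x' y' : vec2 x y + vec2 x' y' = vec2 (x + x') (y + y').
Proof. by apply/rowP=> j; rewrite !mxE; case: ifP. Qed.

Lemma vec2Z l x y : l *: vec2 x y = vec2 (l * x) (l * y).
Proof. by apply/rowP=> j; rewrite !mxE; case: ifP. Qed.

Lemma vec2_inj x y x' y' : vec2 x y = vec2 x' y' -> x = x' /\ y = y'.
Proof. by move/rowP=> e; have := e 0; have := e (lift 0 0); rewrite !mxE. Qed.

Lemma UfP v : reflect (exists x, v = vec2 x (f x)) (v \in U).
Proof. by apply: (iffP imsetP) => [[x _ ->]|[x ->]]; exists x. Qed.

Lemma UfZ l v : l \in Fq F q -> v \in U -> l *: v \in U.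
Proof.
by move=> hl /UfP[x ->]; apply/UfP; exists (l * x); rewrite vec2Z qpolyZ.
Qed.

Lemma Uf_zmod : zmod_closed U.
Proof.
split=> [|u v /UfP[x ->] /UfP[y ->]]; apply/UfP.
  by exists 0; rewrite qpoly0; apply/rowP=> j; rewrite !mxE; case: ifP.
exists (x - y); rewrite -scaleN1r vec2Z vec2D !mulN1r qpolyD; congr (vec2 _ (_ + _)).
by apply/eqP; rewrite eq_sym -addr_eq0 -qpolyD addNr qpoly0.
Qed.

Lemma card_Uf : #|U| = #|F|.
Proof. by rewrite card_imset // => x y /vec2_inj[]. Qed.

(** Scatteredness read on vectors: (y, f y) = c (x, f x) gives y f(x) = x f(y), and in the resulting
    relation l x + m y = 0 the coefficient m is nonzero because x is. *)
Lemma Uf_dependent u v : u \in U -> v \in U -> v != 0 -> u \in span1 v ->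
  exists2 l, l \in Fq F q & u = l *: v.
Proof.
move=> /UfP[y ->] /UfP[x ->] v0 /span1P[c]; rewrite vec2Z => /vec2_inj[yE fyE].
have x0 : x != 0.
  by apply: contraNneq v0 => ->; rewrite qpoly0; apply/eqP/rowP=> j; rewrite !mxE; case: ifP.
have [|l [m [hl hm lm0 lm]]] := hsc (y := x) (z := y).
  by rewrite fyE yE mulrCA mulrA subrr.
have m0 : m != 0.
  apply: contraTneq lm0 => m0; rewrite m0 eqxx orbF; move/eqP: lm.
  by rewrite m0 mul0r addr0 mulf_eq0 (negPf x0) orbF => /eqP ->; rewrite eqxx.
have zFq := Fq_zmod hq hF q1.
have hc : - (l / m) \in Fq F q by apply: GRing.zmod_closedN => //; exact: Fq_div.
exists (- (l / m)) => //; rewrite vec2Z -qpolyZ //; suff <- : y = - (l / m) * x by [].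
apply: (mulfI m0); rewrite mulNr mulrN mulrA mulrCA mulfV // mulr1; apply/eqP.
by rewrite -addr_eq0 addrC; apply/eqP.
Qed.

Lemma Uf_scale_Fq h u : u \in U -> u != 0 -> h *: u \in U -> h \in Fq F q.
Proof.
move=> Uu u0 Uhu; have [l hl /eqP] := Uf_dependent Uhu Uu u0 (scale_span1 h (mem_span1 u)).
by rewrite -subr_eq0 -scalerBl scaler_eq0 (negPf u0) orbF subr_eq0 => /eqP ->.
Qed.

Lemma Uf_ex : exists2 u, u \in U & u != 0.
Proof.
exists (vec2 1 (f 1)); first by apply/UfP; exists 1.
by apply/eqP => /rowP/(_ 0)/eqP; rewrite !mxE oner_eq0.
Qed.

(** By scatteredness U meets [span1 v] in 0 or in the F_q-multiples of one vector. *)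
Lemma card_Uf_span v : (#|U :&: span1 v| <= q)%N.
Proof.
case: (pickP [pred u | [&& u \in U, u \in span1 v & u != 0]]) => [u /= /and3P[Uu uv u0]|none].
  apply: (@leq_trans #|[set l *: u | l in Fq F q]|).
    apply/subset_leq_card/subsetP => w /setIP[Uw wv].
    have wu : w \in span1 u by rewrite -(span1_eq u0 uv).
    by have [l hl ->] := Uf_dependent Uw Uu u0 wu; apply/imsetP; exists l.
  by apply: leq_trans (leq_imset_card _ _) _; rewrite (card_Fq hq hF q1).
apply: (@leq_trans #|[set (0 : V)]|); last by rewrite cards1 ltnW.
apply/subset_leq_card/subsetP => w /setIP[Uw wv]; rewrite inE.
by have := none w; rewrite /= Uw wv /= => /negbFE.
Qed.

Lemma Uf_sub_span v : (U \subset span1 v) = false.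
Proof.
apply/negP => /setIidPl e; have := card_Uf_span v; rewrite e card_Uf leqNgt.
by rewrite (leq_trans _ card_field_gt) // ltnS leq_pmulr // ltnW.
Qed.

Lemma mem_hU h v : h != 0 -> (v \in hU h) = (h^-1 *: v \in U).
Proof.
move=> h0; apply/imsetP/idP => [[u Uu ->]|Uv]; first by rewrite scalerA mulVf // scale1r.
by exists (h^-1 *: v); rewrite // scalerA mulfV // scale1r.
Qed.

Lemma hU_Fq h l : h != 0 -> l != 0 -> l \in Fq F q -> hU (l * h) = hU h.
Proof.
move=> h0 l0 hl; apply/setP=> v; rewrite !mem_hU ?mulf_neq0 // invfM -scalerA.
apply/idP/idP => Uv; last by apply: UfZ => //; rewrite -[l^-1]mul1r Fq_div // inE expr1n.
by have := UfZ hl Uv; rewrite [l *: _]scalerA mulfV // scale1r.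
Qed.

Lemma hU_sub_span h v : h != 0 -> (hU h \subset span1 v) = false.
Proof.
move=> h0; apply/negP => /subsetP sv; have := Uf_sub_span v => /negP[].
apply/subsetP=> u Uu; rewrite -(scalerK h0 u); apply: scale_span1.
by apply: sv; apply/imsetP; exists u.
Qed.

Lemma hU_notD h : h != 0 -> hU h \notin Dspread F.
Proof. by move=> h0; apply/negP => /DspreadP[v _ e]; have := hU_sub_span v h0; rewrite e subxx. Qed.

Lemma LfP W : reflect (exists2 u, u \in U & u != 0 /\ W = span1 u) (W \in Lf q a).
Proof.
apply: (iffP imsetP) => [[x]|[u /UfP[x ->] [u0 ->]]].
  rewrite inE => x0 ->; exists (vec2 x (f x)); first by apply/UfP; exists x.
  by split=> //; apply: contraNneq x0 => /rowP/(_ 0); rewrite !mxE /= => ->.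
exists x; rewrite // inE; apply: contraNneq u0 => ->.
by rewrite qpoly0; apply/eqP/rowP=> j; rewrite !mxE; case: ifP.
Qed.

Lemma BfP W : reflect ((W \in Dspread F /\ W \notin Lf q a) \/ exists2 h : F, h != 0 & W = hU h)
  (W \in B).
Proof.
rewrite in_setU in_setD andbC; apply: (iffP orP) => -[].
- by move/andP; left.
- by case/imsetP=> h; rewrite inE => h0 ->; right; exists h.
- by case=> -> ->; left.
- by case=> h h0 ->; right; apply/imsetP; exists h; rewrite // inE.
Qed.

Lemma hU_Bf h : h != 0 -> hU h \in B.
Proof. by move=> h0; apply/BfP; right; exists h. Qed.

Lemma Uf_Bf : U \in B.
Proof.
apply/BfP; right; exists 1; rewrite ?oner_eq0 //.
by apply/setP=> v; rewrite mem_hU ?oner_eq0 // invr1 scale1r.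
Qed.

Lemma hU_uniq h h' v : h != 0 -> h' != 0 -> v != 0 -> v \in hU h -> v \in hU h' -> hU h = hU h'.
Proof.
move=> h0 h'0 v0; rewrite !mem_hU // => Uv Uv'.
have u0 : h^-1 *: v != 0 by rewrite scaler_eq0 negb_or invr_eq0 h0.
have hh : h / h' \in Fq F q.
  by apply: (Uf_scale_Fq Uv u0); rewrite scalerA mulrAC mulfV // mul1r.
by rewrite -(hU_Fq h'0 _ hh) ?mulf_neq0 ?invr_eq0 // mulfVK.
Qed.

(** A nonzero vector on a point <u> of L_f, with u in U, is some h u and so lies in h U: the sets h
    U replace exactly the points of L_f. *)
Lemma Bf_spread : spread B.
Proof.
split.
- move=> W /BfP[[DW _]|[h h0 ->]]; first exact: (spread_zmod (Dspread_spread F)).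
  split=> [|u v]; rewrite !mem_hU // ?scaler0 ?scalerBr; first exact: Uf_zmod.1.
  exact: Uf_zmod.2.
- move=> W /BfP[[DW _]|[h h0 ->]]; first exact: (spread_card (Dspread_spread F)).
  by rewrite card_imset ?card_Uf //; exact: scalerI.
- move=> v; have [->|v0] := eqVneq v 0; first by exists U; [exact: Uf_Bf | exact: Uf_zmod.1].
  have [/LfP[u Uu [u0 e]]|nL] := boolP (span1 v \in Lf q a).
    have := mem_span1 v; rewrite e => /span1P[h ev].
    exists (hU h); last by apply/imsetP; exists u.
    by apply: hU_Bf; apply: contraNneq v0 => h0; rewrite ev h0 scale0r.
  exists (span1 v); last exact: mem_span1.
  by apply/BfP; left; split=> //; exact: span1_Dspread.
(* A point of D sharing a nonzero vector with some h U belongs to L_f, so it is not a component. *)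
have aux W h v : h != 0 -> W \in Dspread F -> v \in W -> v \in hU h -> v != 0 -> W \in Lf q a.
  move=> h0 /DspreadP[w _ ->] wv /imsetP[u Uu ev] v0; apply/LfP; exists u => //.
  have u0 : u != 0 by apply: contraNneq v0 => u0; rewrite ev u0 scaler0.
  split=> //; rewrite (span1_eq v0 wv); symmetry; apply: span1_eq => //.
  by rewrite ev; exact/scale_span1/mem_span1.
move=> W1 W2 v /BfP[[D1 L1]|[h1 h10 ->]] /BfP[[D2 L2]|[h2 h20 ->]] v1 v2 v0.
- exact: (spread_uniq (Dspread_spread F) D1 D2 v1 v2).
- by rewrite (aux _ _ _ h20 D1 v1 v2 v0) in L1.
- by rewrite (aux _ _ _ h10 D2 v2 v1 v0) in L2.
- exact: (hU_uniq h10 h20 v0).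
Qed.

Lemma Bf_notDP W : reflect (exists2 h : F, h != 0 & W = hU h) (W \in B :\: Dspread F).
Proof.
rewrite in_setD; apply: (iffP andP) => [[nD /BfP[[]|//]]|[h h0 ->]]; first by rewrite (negPf nD).
by rewrite hU_notD // hU_Bf.
Qed.

(** The map h -> h U is constant on the cosets of F_q^*, so each fibre on F^* has at least q - 1 >=
    3 elements, by q > 3. *)
Lemma card_Bf_notD : (3 * #|B :\: Dspread F| < #|F|)%N.
Proof.
pose S := [set h : F | h != 0]; pose g h := hU h.
have gS : g @: S = B :\: Dspread F.
  apply/setP=> W; apply/imsetP/Bf_notDP => -[h]; first by rewrite inE => h0 ->; exists h.
  by move=> h0 ->; exists h; rewrite // inE.
have cS : (#|S| < #|F|)%N.
  rewrite -cardsT; apply/proper_card/properP; split; first exact: subsetT.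
  by exists 0; rewrite ?inE ?eqxx.
apply: leq_ltn_trans cS; rewrite -[#|S|]sum1_card (partition_big_imset g) /= gS.
rewrite mulnC -sum_nat_const.
apply: leq_sum => W /Bf_notDP[h h0 ->]; rewrite sum1_card.
apply: (@leq_trans #|[set l * h | l in Fq F q :\ 0]|).
  rewrite card_imset; last exact: mulIf.
  have := cardsD1 0 (Fq F q); rewrite (Fq_zmod hq hF q1).1 (card_Fq hq hF q1) add1n => e.
  by rewrite -ltnS -e.
apply/subset_leq_card/subsetP => _ /imsetP[l /setD1P[l0 hl] ->].
by rewrite unfold_in /= inE mulf_neq0 //= /g hU_Fq.
Qed.

End ScatteredSpread.

(** * Collineations of A_f fixing the origin *)

Section ScatteredPlane.
Variables (F : finFieldType) (q n : nat) (a : 'I_n -> F).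
Hypotheses (hq : prime_power q) (hF : #|F| = (q ^ n)%N) (hq3 : (3 < q)%N) (hn2 : (2 < n)%N).
Hypothesis hsc : scattered q a.
Local Notation V := 'rV[F]_2.
Local Notation U := (Uf q a).
Local Notation B := (Bf q a).
Local Notation hU h := [set h *: u | u in Uf q a].
Implicit Types (u v w : V) (h c x y l : F) (W : {set V}) (s : V -> V).

Let q1 : (1 < q)%N. Proof. by rewrite (leq_trans _ hq3). Qed.
Let spB : spread B. Proof. exact: (Bf_spread hq hF hq3 hsc). Qed.

Lemma linesP (L : {set V}) : reflect (exists v W, W \in B /\ L = line v W) (L \in lines q a).
Proof.
apply: (iffP imset2P) => [[v W _ BW ->]|[v [W [BW ->]]]]; first by exists v, W.
by exists v W; rewrite // in_setT.
Qed.

Lemma coll_inj s : coll q a s -> injective s.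
Proof. by case/andP=> /injectiveP. Qed.

Lemma coll_line s v W : coll q a s -> W \in B ->
  exists v' W', W' \in B /\ s @: line v W = line v' W'.
Proof.
case/andP=> _ /forallP h BW; apply/linesP; apply: (implyP (h _)).
by apply/linesP; exists v, W.
Qed.

Section FixingOrigin.
Variable s : V -> V.
Hypotheses (s_coll : coll q a s) (s0 : s 0 = 0).

Let s_line v W (BW : W \in B) := coll_line v s_coll BW.

Lemma coll_component W : W \in B -> s @: W \in B.
Proof. exact: (coll0_component spB s0 s_line). Qed.

Lemma coll_additive : {morph s : u v / u + v}.
Proof. exact: (coll0_additive spB (coll_inj s_coll) s0 s_line). Qed.

Lemma coll_semilinear c : exists c', forall v, s (c *: v) = c' *: s v.
Proof.
apply: (spread_semilinear spB (coll_inj s_coll) coll_additive coll_component).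
  by apply: leq_trans (card_field_gt hF hq3 hn2); rewrite ltnS (leq_trans _ (leq_mul hq3 hq3)).
exact: (card_Bf_notD hq hF hq3 hn2 hsc).
Qed.

Lemma collN v : s (- v) = - s v.
Proof. by apply/eqP; rewrite -addr_eq0 -coll_additive addNr s0. Qed.

(* If W = h U, its elements have coordinates, in a basis taken from W, in the subfield E of
   scalars commuting with s.  If E is proper, counting gives W = E u1 + E u2, so E W = W and
   E lies in F_q, which is too small. *)
Lemma coll_fixing_component_linear W : W \in B -> (forall w, w \in W -> s w = w) ->
  forall c v, s (c *: v) = c *: s v.
Proof.
move=> BW sW.
pose E := [set c : F | [forall v, s (c *: v) == c *: s v]].
have EP c : reflect (forall v, s (c *: v) = c *: s v) (c \in E).
  by rewrite inE; apply: (iffP forallP) => h v; apply/eqP.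
suff ET : E = setT by move=> c; apply/EP; rewrite ET inE.
case/BfP: (BW) => [[/DspreadP[w w0 eW] _]|[h h0 eW]].
  apply/setP=> c; rewrite [RHS]inE; apply/EP=> v.
  (* Both w and c w are fixed by s, so the multiplier c' equals c. *)
  have [c' hc'] := coll_semilinear c; rewrite hc'; congr (_ *: _).
  have := hc' w; rewrite !sW ?eW ?scale_span1 ?mem_span1 // => /eqP.
  by rewrite -subr_eq0 -scalerBl scaler_eq0 (negPf w0) orbF subr_eq0 => /eqP.
have zW := spread_zmod spB BW.
have [u1 Wu1 u10] : exists2 u1, u1 \in W & u1 != 0.
  have [u Uu u0] := Uf_ex q a; exists (h *: u); first by rewrite eW; apply/imsetP; exists u.
  by rewrite scaler_eq0 negb_or h0.
have [u2 Wu2 u2u1] : exists2 u2, u2 \in W & u2 \notin span1 u1.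
  case: (pickP [pred u | (u \in W) && (u \notin span1 u1)]) => [u /andP[]|none]; first by exists u.
  have /negP[] := hU_sub_span hq hF hq3 hn2 hsc u1 h0; rewrite -eW.
  by apply/subsetP=> u Wu; have := none u; rewrite /= Wu => /negbFE.
have indep := frame_free u10 u2u1.
have zE : zmod_closed E.
  split=> [|c d /EP hc /EP hd]; apply/EP=> v; first by rewrite !scale0r.
  by rewrite !scalerBl coll_additive collN hc hd.
have dE : {in E &, forall c d, c / d \in E}.
  move=> c d /EP hc /EP hd; have [->|d0] := eqVneq d 0; first by rewrite invr0 mulr0 zE.1.
  apply/EP=> v; apply: (scalerI d0); rewrite -hd !scalerA mulrCA mulfV // mulr1.
  exact: hc.
have [//|cE] := subfield_card zE dE.
pose g (p : F * F) := p.1 *: u1 + p.2 *: u2.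
have WsubE : W \subset g @: setX E E.
  apply/subsetP=> w Ww; have [x [y ew]] := frame_gen w u10 u2u1.
  (* As s fixes x u1 + y u2, u1 and u2, semilinearity gives x' = x and y' = y, so both coordinates
     commute with s. *)
  apply/imsetP; exists (x, y) => //; have [x' hx] := coll_semilinear x.
  have [y' hy] := coll_semilinear y.
  have := sW _ Ww; rewrite ew coll_additive hx hy !sW // => /eqP.
  rewrite -subr_eq0 opprD addrACA -!scalerBl => /eqP /indep[/eqP + /eqP].
  rewrite !subr_eq0 => /eqP ex /eqP ey; rewrite -{}ex -{}ey in hx hy *.
  by apply/setXP; split; apply/EP.
have eWE : W = g @: setX E E.
  apply/eqP; rewrite eqEcard WsubE (spread_card spB BW).
  by apply: leq_trans (leq_imset_card _ _) _; rewrite cardsX.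
have EFq : E \subset Fq F q.
  apply/subsetP=> e Ee; have Weu : e *: u1 \in W.
    rewrite eWE; apply/imsetP; exists (e, 0); first by apply/setXP; split=> //; exact: zE.1.
    by rewrite /g scale0r addr0.
  move: Wu1 Weu; rewrite eW !mem_hU // scalerA mulrC -scalerA => Uu1.
  apply: (Uf_scale_Fq hq hF hq3 hsc Uu1).
  by rewrite scaler_eq0 negb_or invr_eq0 h0.
(* The contradiction is |F| = |W| <= |E|^2 <= q^2 < |F|, the last inequality by n > 2. *)
have := card_field_gt hF hq3 hn2; rewrite ltnNge => /negP[].
rewrite -(spread_card spB BW); apply: leq_trans (subset_leq_card WsubE) _.
apply: leq_trans (leq_imset_card _ _) _; rewrite cardsX.
by have := subset_leq_card EFq; rewrite (card_Fq hq hF q1) => le; exact: leq_mul.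
Qed.

(** Since h U lies in no single point of D, it contains an F-basis of V; the map s is linear by the
    previous lemma and fixes that basis. *)
Lemma coll_fixing_hU h : h != 0 -> (forall w, w \in hU h -> s w = w) -> forall v, s v = v.
Proof.
move=> h0 sW; have BW := hU_Bf q a h0.
have sZ := coll_fixing_component_linear BW sW.
have [u Uu u0] := Uf_ex q a.
have hu0 : h *: u != 0 by rewrite scaler_eq0 negb_or h0.
have Whu : h *: u \in hU h by apply/imsetP; exists u.
case: (pickP [pred w | (w \in hU h) && (w \notin span1 (h *: u))]) => [w /andP[Ww nw]|none].
  move=> v; have [x [y ->]] := frame_gen v hu0 nw.
  by rewrite coll_additive (sZ x) (sZ y) (sW _ Whu) (sW _ Ww).
have /negP[] := hU_sub_span hq hF hq3 hn2 hsc (h *: u) h0.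
by apply/subsetP=> w Ww; have := none w; rewrite /= Ww => /negbFE.
Qed.

End FixingOrigin.

End ScatteredPlane.

(** * Linear maps, scalars and diagonalisation in dimension two *)

Section LinearMaps.
Variable F : finFieldType.
Local Notation V := 'rV[F]_2.
Local Notation GL := {'GL_2[F]}.
Implicit Types (u v w : V) (c x y : F) (g k : GL).

Lemma glmapM g k v : glmap (g * k)%g v = glmap k (glmap g v).
Proof. by rewrite /glmap GL_ME mulmxA. Qed.

Lemma glmap1 v : glmap (1%g : GL) v = v.
Proof. exact: mulmx1. Qed.

Lemma glmapD g : {morph glmap g : u v / u + v}.
Proof. by move=> u v; rewrite /glmap mulmxDl. Qed.

Lemma glmapZ g c v : glmap g (c *: v) = c *: glmap g v.
Proof. by rewrite /glmap -scalemxAl. Qed.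

Lemma glmap0 g : glmap g 0 = 0.
Proof. exact: mul0mx. Qed.

Lemma glmapK g : cancel (glmap g) (glmap g^-1%g).
Proof. by move=> v; rewrite -glmapM mulgV glmap1. Qed.

Lemma glmap_inj g : injective (glmap g).
Proof. exact: can_inj (glmapK g). Qed.

Lemma glmap_eq0 g v : (glmap g v == 0) = (v == 0).
Proof. by rewrite -{1}(glmap0 g) (inj_eq (@glmap_inj g)). Qed.

Lemma GL_ext g k : (forall v, glmap g v = glmap k v) -> g = k.
Proof.
by move=> e; apply: val_inj; apply/row_matrixP => i; rewrite !rowE; exact: (e (delta_mx 0 i)).
Qed.

Lemma glmapX_eigen g c v i : glmap g v = c *: v -> glmap (g ^+ i)%g v = c ^+ i *: v.
Proof.
move=> e; elim: i => [|i IHi]; first by rewrite expg0 glmap1 expr0 scale1r.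
by rewrite expgSr glmapM IHi glmapZ e scalerA -exprSr.
Qed.

Lemma linear_GL (s : V -> V) : injective s -> {morph s : u v / u + v} ->
    (forall c v, s (c *: v) = c *: s v) -> exists g : GL, forall v, s v = glmap g v.
Proof.
move=> s_inj sD sZ; pose A : 'M[F]_2 := \matrix_(i, j) s (delta_mx 0 i) 0 j.
have sA v : s v = v *m A.
  rewrite mulmx_sum_row [in LHS](row_sum_delta v) !big_ord_recl !big_ord0 !addr0 sD !sZ.
  by congr (_ *: _ + _ *: _); apply/rowP=> j; rewrite !mxE.
have Au : A \in unitmx.
  rewrite -row_free_unit -kermx_eq0; apply/rowV0P => v /sub_kermxP; rewrite -sA => sv0.
  by apply: s_inj; rewrite sv0 sA mul0mx.
by exists (FinRing.Unit Au : GL) => v; rewrite sA.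
Qed.

Lemma KerHP g : reflect (exists2 c : F, c != 0 & forall v, glmap g v = c *: v) (g \in KerH F).
Proof.
rewrite inE; apply: (iffP existsP) => -[c].
  by case/andP=> c0 /eqP e; exists c => // v; rewrite /glmap e mul_mx_scalar.
move=> c0 h; exists c; rewrite c0; apply/eqP/row_matrixP => i; rewrite !rowE.
by rewrite [LHS]h mul_mx_scalar.
Qed.

Lemma KerH_ex c : c != 0 -> exists2 g, g \in KerH F & forall v, glmap g v = c *: v.
Proof.
move=> c0; have [||d|g hg] := @linear_GL (fun v => c *: v).
- exact: scalerI.
- by move=> u v; rewrite scalerDr.
- by move=> v; rewrite !scalerA mulrC.
by exists g => [|v]; rewrite ?hg //; apply/KerHP; exists c.
Qed.

Lemma KerH_group_set : group_set (KerH F).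
Proof.
apply/group_setP; split=> [|g k /KerHP[c c0 hc] /KerHP[d d0 hd]]; apply/KerHP.
  by exists 1; rewrite ?oner_eq0 // => v; rewrite glmap1 scale1r.
by exists (d * c); rewrite ?mulf_neq0 // => v; rewrite glmapM hc hd scalerA.
Qed.

Definition KerH_group : {group GL} := Group KerH_group_set.

Lemma KerH_central (S : {set GL}) : S \subset ('C(KerH_group))%g.
Proof.
apply/subsetP=> g _; apply/centP => k /KerHP[c c0 hc].
by apply: GL_ext => v; rewrite !glmapM !hc glmapZ.
Qed.

(** A scalar matrix is determined by its scalar, which [phi] reads off the image of a unit vector.
    It serves with T = F for [KerH] and with T = F_q for the scalars in G_f. *)
Lemma card_scalars (S : {set GL}) (T : {set F}) :
    (forall c, c != 0 -> c \in T <-> exists2 g, g \in S & forall v, glmap g v = c *: v) ->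
  #|KerH F :&: S| = #|T :\ 0|.
Proof.
move=> ST; pose phi g := glmap g (delta_mx 0 0) 0 0.
have phiE g c : (forall v, glmap g v = c *: v) -> phi g = c.
  by move=> e; rewrite /phi e !mxE eqxx mulr1.
rewrite -(@card_in_imset _ _ phi); last first.
  move=> g k /setIP[/KerHP[c _ hc] _] /setIP[/KerHP[d _ hd] _].
  by rewrite (phiE _ _ hc) (phiE _ _ hd) => cd; apply: GL_ext => v; rewrite hc hd cd.
apply: eq_card => c; apply/imsetP/setD1P.
  case=> g /setIP[/KerHP[d d0 hd] Sg] ->; rewrite (phiE _ _ hd); split=> //.
  by apply/ST => //; exists g.
case=> c0 /(ST _ c0)[g Sg hg]; exists g; last by rewrite (phiE _ _ hg).
by apply/setIP; split=> //; apply/KerHP; exists c.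
Qed.

Lemma card_KerH : #|KerH F| = (#|F| - 1)%N.
Proof.
rewrite -[KerH F]setIT (@card_scalars setT setT).
  by rewrite -[in RHS]cardsT (cardsD1 0 setT) inE add1n subn1.
by move=> c c0; split=> // _; have [g _ hg] := KerH_ex c0; exists g; rewrite ?inE.
Qed.

(** From g^|F| = g the minimal polynomial divides X^|F| - X, a product of distinct linear factors
    over F. The rows of the diagonalising matrix are the eigenvectors. *)
Lemma diagonalizable_GL2 g : (g ^+ (#|F| - 1) = 1)%g ->
  exists (e1 e2 : V) x y,
    [/\ e1 != 0, e2 \notin span1 e1, glmap g e1 = x *: e1 & glmap g e2 = y *: e2].
Proof.
move=> gN; have gF : GLval g ^+ #|F| = GLval g.
  have -> : #|F| = (#|F| - 1).+1 by rewrite subn1 (ltn_predK (finNzRing_gt1 F)).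
  have := congr1 val gN; rewrite FinRing.val_unitX /= => e.
  by rewrite exprS [X in _ * X]e mulr1.
have : diagonalizable (GLval g : 'M_2).
  apply/diagonalizableP; exists (enum F); first exact: enum_uniq.
  apply: mxminpoly_min; rewrite big_enum /= -finField_genPoly.
  by rewrite rmorphB /= rmorphXn /= horner_mx_X gF subrr.
case=> P Pu /similar_diagPex[D] /(similarP Pu) PD.
have eP i : glmap g (row i P) = D 0 i *: row i P.
  by rewrite /glmap -row_mul PD row_mul row_diag_mx -scalemxAl -rowE.
have Pindep x y : x *: row 0 P + y *: row (lift 0 0) P = 0 -> x = 0 /\ y = 0.
  move=> e; pose r : 'rV[F]_2 := vec2 x y.
  have : r *m P = 0 by rewrite mulmx_sum_row !big_ord_recl big_ord0 addr0 !mxE.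
  by move/(congr1 (mulmx^~ (invmx P))); rewrite mul0mx mulmxK // => /rowP rE;
     have := rE 0; have := rE (lift 0 0); rewrite !mxE.
exists (row 0 P), (row (lift 0 0) P), (D 0 0), (D 0 (lift 0 0)); split=> //.
  apply/eqP=> e; have [|/eqP] := Pindep 1 0.
    by rewrite e scaler0 scale0r addr0.
  by rewrite oner_eq0.
apply/span1P => -[c e]; have [|_ /eqP] := Pindep (- c) 1.
  by rewrite e scale1r scaleNr addNr.
by rewrite oner_eq0.
Qed.

Definition glaction : {action GL &-> V} :=
  @TotalAction _ _ (fun v g => glmap g v) glmap1 (fun v g k => glmapM g k v).

End LinearMaps.

(** * Linear collineations and the group G_f *)

Section LinearCollineations.
Variables (F : finFieldType) (q n : nat) (a : 'I_n -> F).
Hypotheses (hq : prime_power q) (hF : #|F| = (q ^ n)%N) (hq3 : (3 < q)%N) (hn2 : (2 < n)%N).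
Hypothesis hsc : scattered q a.
Local Notation V := 'rV[F]_2.
Local Notation GL := {'GL_2[F]}.
Local Notation U := (Uf q a).
Local Notation B := (Bf q a).
Local Notation hU h := [set h *: u | u in Uf q a].
Implicit Types (u v w : V) (h c x y l : F) (W : {set V}) (s : V -> V) (g k : GL).

Let q1 : (1 < q)%N. Proof. by rewrite (leq_trans _ hq3). Qed.
Let zU : zmod_closed U. Proof. exact: (Uf_zmod a hq hF hq3). Qed.

Lemma GfP g : reflect (forall u, u \in U -> glmap g u \in U) (g \in Gf q a).
Proof.
rewrite inE; apply: (iffP eqP) => [e u Uu|h]; first by rewrite -e; exact: imset_f.
apply/eqP; rewrite eqEcard (card_imset _ (@glmap_inj _ g)) leqnn andbT.
by apply/subsetP=> _ /imsetP[u Uu ->]; exact: h.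
Qed.

Lemma Gf_group_set : group_set (Gf q a).
Proof.
apply/group_setP; split=> [|g k /GfP hg /GfP hk]; apply/GfP => u Uu; first by rewrite glmap1.
by rewrite glmapM hk ?hg.
Qed.

Definition Gf_group : {group GL} := Group Gf_group_set.

(** The image of U under g is a component. It is not a point of D, since U would then lie in a point
    as well; so it is some c U. Conversely, g sends each h U to (h c) U, and a point whose image is
    in L_f is itself in L_f. *)
Lemma CollGLP g :
  reflect (exists2 c : F, c != 0 & forall u, u \in U -> glmap g u \in hU c) (g \in CollGL q a).
Proof.
rewrite inE; apply: (iffP idP) => [cg|[c c0 gU]].
  have /BfP[[/DspreadP[v v0 e] _]|[c c0 e]] :=
    coll_component hq hF hq3 hsc cg (glmap0 g) (Uf_Bf q a); last first.
    by exists c => // u Uu; rewrite -e imset_f.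
  have /negP[] := Uf_sub_span hq hF hq3 hn2 hsc (glmap g^-1%g v).
  apply/subsetP=> u /(imset_f (glmap g)); rewrite e => /span1P[d ed].
  by apply/span1P; exists d; rewrite -glmapZ -ed glmapK.
have gUE : glmap g @: U = hU c.
  apply/eqP; rewrite eqEcard (card_imset _ (@glmap_inj _ g)) (card_imset _ (scalerI c0)) leqnn.
  by rewrite andbT; apply/subsetP=> _ /imsetP[u Uu ->]; exact: gU.
have gB W : W \in B -> glmap g @: W \in B.
  case/BfP=> [[/DspreadP[w w0 ->] nL]|[h h0 ->]]; apply/BfP; last first.
    right; exists (h * c); rewrite ?mulf_neq0 //; apply/eqP.
    rewrite eqEcard (card_imset _ (@glmap_inj _ g)) (card_imset _ (scalerI (mulf_neq0 h0 c0))).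
    rewrite (card_imset _ (scalerI h0)) leqnn andbT.
    apply/subsetP=> _ /imsetP[_ /imsetP[u Uu ->] ->]; rewrite glmapZ.
    have /imsetP[u' Uu' ->] := gU _ Uu.
    by apply/imsetP; exists u'; rewrite ?scalerA.
  left; have -> : glmap g @: span1 w = span1 (glmap g w).
    apply/setP=> v; apply/imsetP/span1P => [[_ /span1P[d ->] ->]|[d ->]].
      by exists d; rewrite glmapZ.
    by exists (d *: w); rewrite ?glmapZ //; exact/scale_span1/mem_span1.
  split; first by rewrite span1_Dspread ?glmap_eq0.
  apply: contra nL => /(LfP a hq hF hq3)[u Uu [u0 e]]; apply/(LfP a hq hF hq3).
  (* The vector c u is the image of some u1 in U, and u1 lies on <w> because c u lies on the image
     of <w>. *)
  have : c *: u \in glmap g @: U by rewrite gUE; apply/imsetP; exists u.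
  case/imsetP=> u1 Uu1 eu1; exists u1 => //.
  have u10 : u1 != 0 by rewrite -(glmap_eq0 g) -eu1 scaler_eq0 negb_or c0.
  split=> //; apply: span1_eq => //.
  have : c *: u \in span1 (glmap g w) by rewrite e; exact/scale_span1/mem_span1.
  case/span1P=> d ed; apply/span1P; exists d; apply: (@glmap_inj _ g).
  by rewrite glmapZ -eu1.
apply/andP; split; first exact/injectiveP/glmap_inj.
apply/forallP => L; apply/implyP => /linesP[v [W [BW ->]]].
apply/linesP; exists (glmap g v), (glmap g @: W); split; first exact: gB.
apply/setP=> w; apply/imsetP/imsetP => [[_ /imsetP[x Wx ->] ->]|[_ /imsetP[x Wx ->] ->]].
  by exists (glmap g x); rewrite ?imset_f // glmapD.
by exists (v + x); rewrite ?glmapD //; apply/imsetP; exists x.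
Qed.

Lemma CollGL_group_set : group_set (CollGL q a).
Proof.
apply/group_setP; split=> [|g k /CollGLP[c c0 gU] /CollGLP[d d0 kU]]; apply/CollGLP.
  by exists 1 => [|u Uu]; rewrite ?oner_eq0 // glmap1 mem_hU ?oner_eq0 // invr1 scale1r.
exists (c * d) => [|u Uu]; rewrite ?mulf_neq0 // glmapM.
have /imsetP[u' Uu' ->] := gU _ Uu; rewrite glmapZ.
by have /imsetP[v Uv ->] := kU _ Uu'; apply/imsetP; exists v; rewrite ?scalerA.
Qed.

Definition CollGL_group : {group GL} := Group CollGL_group_set.

Lemma KerH_sub_CollGL : KerH F \subset CollGL q a.
Proof.
apply/subsetP=> g /KerHP[c c0 hg]; apply/CollGLP; exists c => // u Uu.
by rewrite hg; apply/imsetP; exists u.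
Qed.

Lemma Gf_sub_CollGL : Gf q a \subset CollGL q a.
Proof.
apply/subsetP=> g /GfP hg; apply/CollGLP; exists 1 => [|u Uu]; rewrite ?oner_eq0 //.
by apply/imsetP; exists (glmap g u); rewrite ?scale1r ?hg.
Qed.

Lemma CollGL_mulg : CollGL q a = (KerH F * Gf q a)%g.
Proof.
apply/eqP; rewrite eqEsubset; apply/andP; split; last first.
  by rewrite -[CollGL q a]/(gval CollGL_group) mul_subG // ?KerH_sub_CollGL ?Gf_sub_CollGL.
apply/subsetP=> g /CollGLP[c c0 gU].
have [k kK hk] := KerH_ex (invr_neq0 c0).
apply/mulsgP; exists k^-1%g (k * g)%g; rewrite ?mulKg //.
  exact: (@groupVr _ (KerH_group F)).
apply/GfP=> u Uu; rewrite glmapM hk glmapZ.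
by have := gU _ Uu; rewrite mem_hU.
Qed.

Lemma card_KerH_Gf : #|KerH F :&: Gf q a| = (q - 1)%N.
Proof.
have zFq := Fq_zmod hq hF q1.
rewrite (@card_scalars _ _ (Fq F q)).
  by have := cardsD1 0 (Fq F q); rewrite zFq.1 (card_Fq hq hF q1) => {2}->; rewrite add1n subn1.
move=> c c0; split=> [cF|[g /GfP hg hc]].
  have [g _ hg] := KerH_ex c0; exists g => //; apply/GfP => u Uu.
  by rewrite hg; exact: UfZ.
have [u Uu u0] := Uf_ex q a.
by apply: (Uf_scale_Fq hq hF hq3 hsc Uu u0); rewrite -hc hg.
Qed.

(* d = g - 1 has rank at most one, and U meets both its kernel and its image in at most q
   vectors; so d = 0, as |U| > q^2. *)
Lemma Gf_free g u : g \in Gf q a -> u \in U -> u != 0 -> glmap g u = u -> g = 1%g.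
Proof.
move=> /GfP gU Uu u0 gu; pose d v := glmap g v - v.
have dD v w : d (v + w) = d v + d w by rewrite /d glmapD opprD addrACA.
have dZ c v : d (c *: v) = c *: d v by rewrite /d glmapZ scalerBr.
have du : d u = 0 by rewrite /d gu subrr.
have [e e_u] := spread_notin (Dspread_spread F) (span1_Dspread u0).
have dE x y : d (x *: u + y *: e) = y *: d e by rewrite dD !dZ du scaler0 add0r.
have [de0|de0] := eqVneq (d e) 0.
  apply: GL_ext => v; rewrite glmap1; apply/eqP; rewrite -subr_eq0 -/(d v).
  by have [x [y ->]] := frame_gen v u0 e_u; rewrite dE de0 scaler0.
have := card_field_gt hF hq3 hn2; rewrite ltnNge => /negP[].
have cspan := card_Uf_span hq hF hq3 hsc.
rewrite -(card_Uf q a) -[#|U|]sum1_card (partition_big_imset d) /=.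
apply: (@leq_trans (\sum_(z in d @: U) q)); last first.
  rewrite sum_nat_const leq_mul2r; apply/orP; right; apply: leq_trans (cspan (d e)).
  apply/subset_leq_card/subsetP => _ /imsetP[w Uw ->]; apply/setIP; split.
    by apply: zU.2; rewrite ?gU.
  by have [x [y ->]] := frame_gen w u0 e_u; rewrite dE; exact/scale_span1/mem_span1.
apply: leq_sum => _ /imsetP[w Uw ->]; rewrite sum1_card.
apply: leq_trans (cspan u); rewrite -[X in (_ <= X)%N](card_imset _ (@addrI _ w)).
apply/subset_leq_card/subsetP => w'.
rewrite -[_ \in _]/((w' \in U) && (d w' == d w)) => /andP[Uw' /eqP dw].
apply/imsetP; exists (w' - w); last by rewrite addrC subrK.
apply/setIP; split; first exact: zU.2.
have [x [y ew]] := frame_gen (w' - w) u0 e_u.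
have : d (w' - w) = 0.
  have : d (w' - w + w) = d w by rewrite subrK.
  by rewrite dD => /eqP; rewrite -subr_eq0 addrK => /eqP.
rewrite ew dE => /eqP; rewrite scaler_eq0 (negPf de0) orbF => /eqP ->.
by rewrite scale0r addr0; exact/scale_span1/mem_span1.
Qed.

Lemma Gf_orbit_inj u : u \in U -> u != 0 -> {in Gf q a &, injective (fun g => glmap g u)}.
Proof.
move=> Uu u0 g k Gg Gk /= e; apply/eqP; rewrite eq_mulgV1; apply/eqP.
have Ggk : (g * k^-1)%g \in Gf_group.
  exact: (@groupM _ Gf_group _ _ Gg (@groupVr _ Gf_group _ Gk)).
by apply: (Gf_free Ggk Uu u0); rewrite glmapM e glmapK.
Qed.

(** By [Gf_free] every orbit of G_f on the |F| - 1 nonzero vectors of U is regular. *)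
Lemma Gf_card_dvd : (#|Gf q a| %| #|F| - 1)%N.
Proof.
pose S := U :\ 0.
have cS : #|S| = (#|F| - 1)%N.
  by have := cardsD1 0 U; rewrite zU.1 card_Uf => ->; rewrite add1n subn1.
have actS : [acts Gf_group, on S | glaction F].
  apply/actsP=> g Gg v; rewrite !in_setD1 [glaction F v g]/(glmap g v) glmap_eq0; congr (_ && _).
  apply/idP/idP => [Ugv|]; last by move/GfP: Gg; apply.
  by rewrite -(glmapK g v); have /GfP := @groupVr _ Gf_group _ Gg; apply.
rewrite -cS (@card_uniform_partition _ #|Gf q a| _ _ _ (orbit_partition actS)) ?dvdn_mull //.
move=> _ /imsetP[u /setD1P[u0 Uu] ->]; rewrite /orbit card_in_imset //.
exact: Gf_orbit_inj.
Qed.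

Lemma Gf_diagonalizable g : g \in Gf q a -> exists (e1 e2 : V) x y,
  [/\ e1 != 0, e2 \notin span1 e1, glmap g e1 = x *: e1 & glmap g e2 = y *: e2].
Proof.
move=> Gg; apply: diagonalizable_GL2; apply/eqP; rewrite -order_dvdn.
by apply: dvdn_trans Gf_card_dvd; exact: (@order_dvdG _ Gf_group).
Qed.

End LinearCollineations.

(** * Central collineations and groups of homologies *)

Section CentralCollineations.
Variables (F : finFieldType) (q n : nat) (a : 'I_n -> F).
Hypotheses (hq : prime_power q) (hF : #|F| = (q ^ n)%N) (hq3 : (3 < q)%N) (hn2 : (2 < n)%N).
Hypothesis hsc : scattered q a.
Local Notation V := 'rV[F]_2.
Local Notation GL := {'GL_2[F]}.
Local Notation U := (Uf q a).
Local Notation B := (Bf q a).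
Implicit Types (u v w e : V) (c x y l : F) (L W : {set V}) (s : V -> V) (g k d : GL).

Let spB : spread B. Proof. exact: (Bf_spread hq hF hq3 hsc). Qed.

Lemma coll_ext s s' : s =1 s' -> coll q a s = coll q a s'.
Proof.
move=> e; rewrite /coll; congr (_ && _).
  by apply/injectiveP/injectiveP => s_inj v w; [rewrite -!e | rewrite !e]; exact: s_inj.
by apply: eq_forallb => L; rewrite (eq_imset _ e).
Qed.

Lemma line_inj v v' W W' : zmod_closed W -> zmod_closed W' -> line v W = line v' W' -> W = W'.
Proof.
move=> zW zW' e; have : v \in line v' W' by rewrite -e mem_line subrr zW.1.
move/(line_eq zW') => e'; apply/setP=> u.
have mem_add (X : {set V}) : (u \in X) = (v + u \in line v X) by rewrite mem_line addrC addKr.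
by rewrite (mem_add W) (mem_add W') e e'.
Qed.

Lemma add_line u v W : [set w + u | w in line v W] = line (v + u) W.
Proof.
apply/setP=> w; rewrite mem_line; apply/imsetP/idP => [[w' + ->]|Ww].
  by rewrite mem_line opprD addrACA subrr addr0.
by exists (w - u); rewrite ?subrK // mem_line -addrA [- u - v]addrC -opprD.
Qed.

Lemma coll_translate s v : coll q a s -> coll q a (fun u => s (u + v) - v).
Proof.
move=> cs; apply/andP; split.
  by apply/injectiveP => u w /addIr /(coll_inj cs) /addIr.
apply/forallP => L; apply/implyP => /linesP[u [W [BW ->]]].
have [v' [W' [BW' e]]] := coll_line (u + v) cs BW.
apply/linesP; exists (v' - v), W'; split=> //.
by rewrite -add_line -e -add_line -!imset_comp.
Qed.

(** The map [t] is s conjugated by a translation, so that its axis is a component A. As t is not the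
    identity, A is no h U, so A = <e> and t is linear, given by g. Fixing all lines through W means
    that t moves each vector within its coset of W. *)
Lemma affine_central_linear s L W : affine_central q a s L W ->
  exists v e g, [/\ e != 0, L = line v (span1 e), g \in CollGL q a & g != 1%g] /\
    [/\ W \in B, glmap g e = e & forall u, glmap g u - u \in W].
Proof.
case=> -[cs [x0 /eqP nx] /linesP[v [A [BA LE]]] sL] [BW sW].
pose t u := s (u + v) - v.
have ct : coll q a t by exact: coll_translate.
have zA := spread_zmod spB BA.
have tA u : u \in A -> t u = u.
  by move=> Au; rewrite /t sL ?addrK // LE mem_line addrK.
have t0 : t 0 = 0 by rewrite tA ?zA.1.
have sE u : s u = t (u - v) + v by rewrite /t !subrK.
case/BfP: (BA) => [[/DspreadP[e e0 AE] _]|[h h0 AE]]; last first.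
  case: nx; rewrite sE; rewrite AE in tA.
  by rewrite (coll_fixing_hU hq hF hq3 hn2 hsc ct t0 h0 tA) subrK.
have tZ := coll_fixing_component_linear hq hF hq3 hn2 hsc ct t0 BA tA.
have [g gE] := linear_GL (coll_inj ct) (coll_additive hq hF hq3 hsc ct t0) tZ.
exists v, e, g; split; split=> //.
- by rewrite LE AE.
- by rewrite inE -(coll_ext gE).
- by apply/eqP=> g1; case: nx; rewrite sE gE g1 glmap1 subrK.
- by rewrite -gE tA // AE mem_span1.
move=> u; rewrite -gE /t -addrA -opprD [v + u]addrC -mem_line -[line _ _]sW.
by rewrite imset_f // mem_line subrr (spread_zmod spB BW).1.
Qed.

Lemma frame_sym e1 e2 : e1 != 0 -> e2 \notin span1 e1 -> e2 != 0 /\ e1 \notin span1 e2.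
Proof.
move=> e10 e2e1; split; first by apply: contraNneq e2e1 => ->; exact: (span1_zmod _).1.
by apply: contra e2e1 => /(span1_eq e10) <-; exact: mem_span1.
Qed.

Lemma GL_frame_eq1 e1 e2 g : e1 != 0 -> e2 \notin span1 e1 ->
  glmap g e1 = e1 -> glmap g e2 = e2 -> g = 1%g.
Proof.
move=> e10 e2e1 ge1 ge2; apply: GL_ext => v; rewrite glmap1.
by have [x [y ->]] := frame_gen v e10 e2e1; rewrite glmapD !glmapZ ge1 ge2.
Qed.

(** As d fixes e1 and scales e2, every d v - v lies in <e2>, so all lines in that direction are
    preserved. Any function [s] agreeing with [glmap d] is allowed, to serve both matrices and
    permutations. *)
Lemma frame_homology e1 e2 d y s : s =1 glmap d -> d \in CollGL q a -> d != 1%g ->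
    e1 != 0 -> e2 \notin span1 e1 -> span1 e1 \in B -> span1 e2 \in B ->
    glmap d e1 = e1 -> glmap d e2 = y *: e2 ->
  affine_homology q a s (span1 e1) (span1 e2).
Proof.
move=> sd cd d1 e10 e2e1 B1 B2 de1 de2; rewrite inE -(coll_ext sd) in cd.
have z2 := span1_zmod e2.
have smem v : s v - v \in span1 e2.
  have [x [z ->]] := frame_gen v e10 e2e1.
  rewrite sd glmapD !glmapZ de1 de2 opprD addrACA subrr add0r -scalerBr.
  by apply: scale_span1; apply: z2.2; rewrite ?scale_span1 ?mem_span1.
split; last first.
  case=> v e; have := line_inj (span1_zmod e1) z2 (etrans (line0 _) e) => e'.
  by rewrite e' mem_span1 in e2e1.
split; split=> //.
- case: (pickP (fun v => s v != v)) => [v nv|fixs]; first by exists v; exact: nv.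
  case/eqP: d1; apply: GL_ext => v; rewrite glmap1 -sd.
  by have := fixs v => /negbFE/eqP.
- by apply/linesP; exists 0, (span1 e1); rewrite line0.
- by move=> _ /span1P[c ->]; rewrite sd glmapZ de1.
move=> v; apply/eqP; rewrite eqEcard (card_imset _ (coll_inj cd)) leqnn andbT.
apply/subsetP=> _ /imsetP[u + ->]; rewrite !mem_line => uv.
by rewrite -[s u](subrK u) -addrA; exact: (GRing.zmod_closedD z2).2.
Qed.

(** Passes from permutations of [V], in which symmetric homology groups are stated, to matrices. *)
Lemma perm_cycleE g p : p \in <[perm (@glmap_inj _ g)]>%g ->
  exists2 d, d \in <[g]>%g & p =1 glmap d.
Proof.
case/cycleP=> i ->; exists (g ^+ i)%g; first exact: mem_cycle.
elim: i => [|i IHi] v; first by rewrite !expg0 perm1 glmap1.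
by rewrite !expgSr permM permE glmapM IHi.
Qed.

Lemma order_perm_glmap g : #[perm (@glmap_inj _ g)]%g = #[g]%g.
Proof.
set p := perm _; have pX i v : (p ^+ i)%g v = glmap (g ^+ i)%g v.
  elim: i v => [|i IHi] v; first by rewrite !expg0 perm1 glmap1.
  by rewrite !expgSr permM permE glmapM IHi.
apply/eqP; rewrite eqn_dvd !order_dvdn; apply/andP; split; apply/eqP.
  by apply/permP=> v; rewrite pX expg_order glmap1 perm1.
by apply: GL_ext => v; rewrite -pX expg_order glmap1 perm1.
Qed.

Section CyclicStabilizer.
Variable g : GL.
Hypotheses (Gfg : Gf q a = <[g]>%g) (cGf : (q - 1 < #|Gf q a|)%N).

(* Otherwise U would meet the eigenline in a whole regular orbit of G_f and the origin. *)
Lemma eigenline_component e x : e != 0 -> glmap g e = x *: e -> span1 e \in B.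
Proof.
move=> e0 ge; apply/BfP; left; split; first exact: span1_Dspread.
apply/negP => /(LfP a hq hF hq3)[u Uu [u0 eu]].
have ue : u \in span1 e by rewrite eu mem_span1.
have := card_Uf_span hq hF hq3 hsc e; rewrite leqNgt => /negP[].
have zU := Uf_zmod a hq hF hq3.
apply: (@leq_trans #|0 |: [set glmap k u | k in Gf q a]|).
  rewrite cardsU1 card_in_imset; last exact: (Gf_orbit_inj hq hF hq3 hn2 hsc).
  case: imsetP => [[k _ /eqP]|_]; first by rewrite eq_sym glmap_eq0 (negPf u0).
  by rewrite add1n ltnS; move: cGf; rewrite subn1 (ltn_predK hq3).
apply/subset_leq_card/subsetP => v; rewrite in_setU1 => /orP[/eqP ->|/imsetP[k Gk ->]].
  by apply/setIP; split; [exact: zU.1 | exact: (span1_zmod _).1].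
apply/setIP; split; first by move/GfP: Gk; apply.
move: Gk; rewrite Gfg => /cycleP[i ->]; case/span1P: ue => c ->.
by rewrite glmapZ (glmapX_eigen i ge) !scale_span1 ?mem_span1.
Qed.

(** Every linear collineation is a scalar times a power of g, so it keeps the eigenvectors of g. *)
Lemma CollGL_eigen k e x : k \in CollGL q a -> glmap g e = x *: e ->
  exists y, glmap k e = y *: e.
Proof.
rewrite (CollGL_mulg hq hF hq3 hn2 hsc) Gfg => /mulsgP[h _ /KerHP[c _ hc] /cycleP[i ->] ->] ge.
by exists (c * x ^+ i); rewrite glmapM hc glmapZ (glmapX_eigen i ge) scalerA.
Qed.

(** The generator is d = x^-1 g. A scalar power of d fixes e, hence is 1, so <[d]> meets [KerH]
    trivially. The products of [KerH] with <[d]> and with G_f coincide; comparing orders, with q - 1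
    scalars in G_f, gives the order of d. *)
Lemma eigen_homology_group e x : e != 0 -> glmap g e = x *: e ->
  exists2 d : GL, glmap d e = e & [/\ d \in CollGL q a,
    #|<[d]>%g| = (#|Gf q a| %/ (q - 1))%N & (KerH F \x <[d]>)%g = CollGL q a].
Proof.
move=> e0 ge; have x0 : x != 0.
  by apply: contraNneq e0 => x0; rewrite -(glmap_eq0 g) ge x0 scale0r.
have CollE := CollGL_mulg hq hF hq3 hn2 hsc.
have [k kK hk] := KerH_ex (invr_neq0 x0); pose d := (k * g)%g.
have de : glmap d e = e by rewrite glmapM hk glmapZ ge scalerA mulVf // scale1r.
pose K := KerH_group F.
have cKd : <[d]>%g \subset 'C(K)%g by exact: KerH_central.
have Ktriv : K :&: <[d]>%g = 1%g.
  apply/trivgP/subsetP => b /setIP[/KerHP[c c0 hc] /cycleP[i ei]].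
  rewrite {b}ei in hc *; rewrite inE; apply/eqP/GL_ext => v.
  have d1 : glmap d e = 1 *: e by rewrite scale1r.
  have := hc e; rewrite (glmapX_eigen i d1) expr1n => /eqP.
  rewrite -subr_eq0 -scalerBl scaler_eq0 (negPf e0) orbF subr_eq0 => /eqP c1.
  by rewrite hc glmap1 -c1 scale1r.
have CollGLd : (KerH F * <[d]>)%g = CollGL q a.
  apply/eqP; rewrite eqEsubset; apply/andP; split.
    rewrite -[CollGL q a]/(gval (CollGL_group hq hF hq3 hn2 hsc)) mul_subG ?KerH_sub_CollGL //.
    by rewrite cycle_subG /= CollE; apply/mulsgP; exists k g; rewrite // Gfg cycle_id.
  have Kd := cent_joinEr cKd; rewrite -[(KerH F * _)%g]/(K * _)%g -Kd CollE mul_subG ?joing_subl //.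
  rewrite Gfg cycle_subG -(mulKg k g) groupM ?groupV //.
    by apply: (subsetP (joing_subl _ _)).
  by apply: (subsetP (joing_subr _ _)); exact: cycle_id.
exists d => //; split; first by rewrite CollE; apply/mulsgP; exists k g; rewrite // Gfg cycle_id.
  have := mul_cardG K (Gf_group q a); have := mul_cardG K <[d]>%G.
  rewrite /= CollGLd CollE Ktriv cards1 muln1 (card_KerH_Gf hq hF hq3 hsc) => <- /eqP.
  rewrite -mulnA eqn_pmul2l ?card_gt0; last by apply/set0Pn; exists k.
  by move/eqP->; rewrite mulnK // subn_gt0 (leq_trans _ hq3).
by rewrite -[KerH F]/(gval K) dprodE.
Qed.

(** The linear part k scales e1 by [al] and e2 by [be], not both 1, and fixes e, which spans the
    axis direction. A nonzero coordinate of e forces its scalar to be 1, so e lies on one eigenline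
    and the other is the center. *)
Lemma affine_central_frame e1 e2 x y s L W :
    e1 != 0 -> e2 \notin span1 e1 -> glmap g e1 = x *: e1 -> glmap g e2 = y *: e2 ->
    affine_central q a s L W ->
  exists v, (L = line v (span1 e1) /\ W = span1 e2) \/ (L = line v (span1 e2) /\ W = span1 e1).
Proof.
move=> e10 e2e1 ge1 ge2 /affine_central_linear[v [e [k [[e0 -> ck k1] [BW ke kW]]]]].
have [e20 e1e2] := frame_sym e10 e2e1.
have B1 := eigenline_component e10 ge1; have B2 := eigenline_component e20 ge2.
have [al k1E] := CollGL_eigen ck ge1; have [be k2E] := CollGL_eigen ck ge2.
have [z1 [z2 eE]] := frame_gen e e10 e2e1.
have [h1 h2] : al * z1 - z1 = 0 /\ be * z2 - z2 = 0.
  apply: (frame_free e10 e2e1); apply/eqP; move/eqP: ke.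
  rewrite eE glmapD !glmapZ k1E k2E !scalerA -subr_eq0 opprD addrACA -!scalerBl.
  by rewrite ![_ * al]mulrC ![_ * be]mulrC.
(* The nonzero vector (c - 1) e' is the displacement of e' under k, so it lies in the center W. *)
have center e' c : e' != 0 -> span1 e' \in B -> glmap k e' = c *: e' -> c != 1 -> W = span1 e'.
  move=> e'0 B' ke' c1; apply: (spread_uniq spB BW B' (kW e')).
    by rewrite ke' -{2}[e']scale1r -scalerBl scale_span1 ?mem_span1.
  by rewrite ke' -{2}[e']scale1r -scalerBl scaler_eq0 negb_or subr_eq0 c1.
have eig1 c z : z != 0 -> c * z - z = 0 -> c = 1.
  by move=> z0 /eqP; rewrite -{2}[z]mul1r -mulrBl mulf_eq0 (negPf z0) orbF subr_eq0 => /eqP.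
have k1' : al = 1 -> be = 1 -> False.
  move=> al1 be1; case/eqP: k1; apply: (GL_frame_eq1 e10 e2e1).
    by rewrite k1E al1 scale1r.
  by rewrite k2E be1 scale1r.
exists v; have [z20|z20] := eqVneq z2 0.
  have z10 : z1 != 0 by apply: contraNneq e0 => z10; rewrite eE z10 z20 !scale0r addr0.
  left; split.
    congr (line v _); symmetry; apply: span1_eq => //.
    by rewrite eE z20 scale0r addr0 scale_span1 ?mem_span1.
  by apply: center k2E _ => //; apply/eqP; exact: (k1' (eig1 _ _ z10 h1)).
have be1 := eig1 _ _ z20 h2.
have z10 : z1 = 0 by apply/eqP/negPn/negP => z10; exact: (k1' (eig1 _ _ z10 h1) be1).
right; split.
  congr (line v _); symmetry; apply: span1_eq => //.
  by rewrite eE z10 scale0r add0r scale_span1 ?mem_span1.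
by apply: center k1E _ => //; apply/eqP => al1; exact: (k1' al1 be1).
Qed.

End CyclicStabilizer.

End CentralCollineations.

(** * The two cases: G_f consisting of scalars, and G_f cyclic and larger *)

Theorem theorem5p4 (F : finFieldType) (q n : nat) (a : 'I_n -> F)
  (hq : prime_power q) (hF : #|F| = (q ^ n)%N) (hq3 : (3 < q)%N) (hn2 : (2 < n)%N)
  (hsc : scattered q a) :
  (* (i) *)
  (#|Gf q a| = (q - 1)%N ->
     (forall H : {group {perm 'rV[F]_2}},
        (forall s, s \in H -> s != 1%g -> exists l W, affine_central q a s l W) ->
        H = 1%G :> {set _}) /\
     #|CollGL q a| = (q ^ n - 1)%N /\ CollGL q a = KerH F) /\
  (* (ii) *)
  (forall (t : nat) (K : finFieldType),
     (q - 1 < #|Gf q a|)%N -> #|K| = (q ^ t)%N ->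
     [set: {unit K}] \isog Gf q a ->
     (exists G H : {group {perm 'rV[F]_2}},
        [/\ cyclic G, cyclic H, #|G| = ((q ^ t - 1) %/ (q - 1))%N,
            #|H| = ((q ^ t - 1) %/ (q - 1))%N &
            symmetric_affine_homology_groups q a G H]) /\
     (~ exists s l W, affine_elation q a s l W) /\
     (exists X Y : {set 'rV[F]_2},
        [/\ X \in Bf q a, Y \in Bf q a, X != Y & X \in Dspread F /\ Y \in Dspread F] /\
        forall s l W, affine_homology q a s l W -> W = X \/ W = Y) /\
     (exists C : {group {'GL_2[F]}},
        [/\ cyclic C, #|C| = ((q ^ t - 1) %/ (q - 1))%N,
            (KerH F \x C)%g = CollGL q a &
            exists l W, forall g, g \in C -> g != 1%g ->
              affine_homology q a (glmap g) l W])).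
Proof.
have CollE := CollGL_mulg hq hF hq3 hn2 hsc.
have cKG := card_KerH_Gf hq hF hq3 hsc.
split=> [cGf|t K cGf cK isoK].
  (* G_f has order q - 1 and contains q - 1 scalars, so all its elements are scalars. *)
  have GfK : Gf q a \subset KerH F.
    apply/setIidPr/eqP; rewrite eqEcard subsetIr /= cKG cGf //.
  have CollK : CollGL q a = KerH F.
    rewrite CollE; apply/eqP; rewrite eqEsubset; apply/andP; split.
      by rewrite -[KerH F]/(gval (KerH_group F)) mul_subG.
    by apply: mulg_subl; exact: (group1 (Gf_group q a)).
  split; last by rewrite CollK card_KerH hF.
  move=> H hH; apply/trivgP/subsetP => s Hs; rewrite inE; apply/negPn/negP => s1.
  have [l [W /(affine_central_linear hq hF hq3 hn2 hsc)]] := hH s Hs s1.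
  (* The linear part g is a scalar and fixes e, hence is 1. *)
  case=> v [e [g [[e0 _ + g1] [_ ge _]]]]; rewrite CollK => /KerHP[c c0 hc].
  case/eqP: g1; apply: GL_ext => w; rewrite glmap1 hc.
  move/eqP: ge; rewrite hc -{2}[e]scale1r -subr_eq0 -scalerBl scaler_eq0 (negPf e0) orbF.
  by rewrite subr_eq0 => /eqP ->; rewrite scale1r.
have {isoK} isoK : [set: {unit K}]%G \isog Gf_group q a by exact: isoK.
have cGfE : #|Gf q a| = (q ^ t - 1)%N.
  by rewrite -[Gf q a]/(gval (Gf_group q a)) -(card_isog isoK) card_finField_unit cK subn1.
have /cyclicP[g Gfg] : cyclic (Gf_group q a).
  rewrite -(isog_cyclic isoK).
  exact: field_unit_group_cyclic.
have Gg : g \in Gf q a by rewrite -[Gf q a]/(gval (Gf_group q a)) Gfg cycle_id.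
have [e1 [e2 [x [y [e10 e2e1 ge1 ge2]]]]] := Gf_diagonalizable hq hF hq3 hn2 hsc Gg.
have [e20 e1e2] := frame_sym e10 e2e1.
have B1 := eigenline_component hq hF hq3 hn2 hsc Gfg cGf e10 ge1.
have B2 := eigenline_component hq hF hq3 hn2 hsc Gfg cGf e20 ge2.
have n12 : span1 e1 != span1 e2 by apply: contraNneq e2e1 => ->; exact: mem_span1.
have [d1 d1e [d1C d1o d1K]] := eigen_homology_group hq hF hq3 hn2 hsc Gfg e10 ge1.
have [d2 d2e [d2C d2o d2K]] := eigen_homology_group hq hF hq3 hn2 hsc Gfg e20 ge2.
(* A nonidentity element of <[d]> fixes e and, as a linear collineation, scales e'; so it is a
   homology with axis <e> and center <e'>. *)
have hom e e' z d k (s : 'rV[F]_2 -> 'rV[F]_2) :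
    e != 0 -> e' \notin span1 e -> span1 e \in Bf q a -> span1 e' \in Bf q a ->
    glmap g e' = z *: e' -> d \in CollGL q a -> glmap d e = e -> k \in <[d]>%g -> k != 1%g ->
    s =1 glmap k -> affine_homology q a s (span1 e) (span1 e').
  move=> e0 e'e Be Be' ge' dC de kd k1 sk.
  have kC : k \in CollGL q a.
    have : <[d]>%g \subset CollGL_group hq hF hq3 hn2 hsc by rewrite cycle_subG.
    by move/subsetP; apply.
  have [z' kz'] := CollGL_eigen hq hF hq3 hn2 hsc Gfg kC ge'.
  have de1 : glmap d e = 1 *: e by rewrite scale1r.
  apply: (frame_homology sk kC k1 e0 e'e Be Be' _ kz').
  case/cycleP: kd => i ->.
  by rewrite (glmapX_eigen i de1) expr1n scale1r.
have perm_hom e e' z d (s : {perm 'rV[F]_2}) : e != 0 -> e' \notin span1 e ->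
    span1 e \in Bf q a -> span1 e' \in Bf q a ->
    glmap g e' = z *: e' -> d \in CollGL q a -> glmap d e = e ->
    s \in <[perm (@glmap_inj _ d)]>%g -> s != 1%g ->
    affine_homology q a s (span1 e) (span1 e').
  move=> e0 e'e Be Be' ge' dC de /perm_cycleE[k kd sk] s1.
  apply: (hom e e' z d k s) => //; apply: contraNneq s1 => k1.
  by apply/eqP/permP => v; rewrite sk k1 glmap1 perm1.
split.
  exists <[perm (@glmap_inj _ d1)]>%G, <[perm (@glmap_inj _ d2)]>%G.
  rewrite !cycle_cyclic -!orderE !order_perm_glmap !orderE d1o d2o cGfE; split=> //.
  (* Each of the two eigenlines is the axis of one group and the center of the other; being a line
     through its own point at infinity, it is also a coaxis of the latter. *)
  exists (span1 e1), (span1 e2); split=> s Hs s1.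
    exists (span1 e2); split; last by exists 0; rewrite line0.
    exact: (perm_hom e1 e2 y d1).
  exists (span1 e1); split; last by exists 0; rewrite line0.
  exact: (perm_hom e2 e1 x d2).
have frame s l W := @affine_central_frame _ _ _ _ hq hF hq3 hn2 hsc _ Gfg cGf _ _ _ _ s l W
  e10 e2e1 ge1 ge2.
have z1 := span1_zmod e1; have z2 := span1_zmod e2.
split.
  (* An elation has its axis in the direction of its center, whereas axis and center here belong to
     different eigenlines. *)
  case=> s [l [W [/frame[v vE] [v' lE]]]]; case/eqP: n12.
  case: vE => -[lv WE]; have := etrans (esym lv) lE; rewrite WE => /line_inj e; first exact: e.
  by rewrite e.
split.
  exists (span1 e1), (span1 e2); split; first by rewrite !span1_Dspread.
  by move=> s l W [/frame[v [[_ ->]|[_ ->]]] _]; [right | left].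
exists <[d1]>%G; rewrite cycle_cyclic d1o cGfE; split=> //.
exists (span1 e1), (span1 e2) => k kd k1.
exact: (hom e1 e2 y d1 k).
Qed.
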